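(* Let $K$ be a field, $Q$ a finite quiver, $\succ$ a length admissible order on the set $\mathcal B$ of paths of $Q$, and $\mathcal T$ a set of paths of length $2$ in $Q$. If $\mathcal N=\mathcal B\setminus\mathrm{tip}(\langle\mathcal T\rangle)$ is a finite set and $\Lambda,\Lambda'\in\mathrm{GrAlg}(\mathcal T)$, then $$\operatorname{gl.dim}(\Lambda)=\operatorname{gl.dim}(\Lambda').$$
   Context: $\operatorname{gl.dim}$ denotes global dimension (possibly infinite). $KQ$ is the path algebra, $\mathcal B$ the set of all finite directed paths in $Q$ (vertices are paths of length $0$), $\ell(p)$ the length of a path; paths are written left to right, so a path $p$ from $v$ to $w$ satisfies $vpw=p$. ''Ideal'' means two-sided ideal and $\langle X\rangle$ is the two-sided ideal generated by $X$. A length admissible order is a well-order $\succ$ on $\mathcal B$ such that for $p,q,r,s,t\in\mathcal B$: $p\succ q$ implies $pr\succ qr$ if both are nonzero; $p\succ q$ implies $sp\succ sq$ if both are nonzero; $p=rqt$ implies $p\succeq q$; and $\ell(p)>\ell(q)$ implies $p\succ q$. For nonzero $x=\sum_{p\in\mathcal B}\alpha_p p\in KQ$, $\mathrm{tip}(x)$ is the $\succ$-largest $p$ with $\alpha_p\neq 0$; for $X\subseteq KQ$, $\mathrm{tip}(X)=\{\mathrm{tip}(x): x\in X, x\ne 0\}$. A nonzero $x$ is uniform if $x=vxw$ for some vertices $v,w$; an element is quadratic if it is a $K$-linear combination of paths of length $2$. An ideal is graded if it is generated by length homogeneous elements. A Gröbner basis of a graded ideal $I$ is a set $\mathcal G\subseteq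 I$ of length homogeneous uniform elements with $\langle\mathrm{tip}(\mathcal G)\rangle=\langle \mathrm{tip}(I)\rangle$. $KQ/I$ is a strong Koszul algebra (with respect to $I$ and $\succ$) if $I$ has a Gröbner basis with respect to $\succ$ consisting of quadratic elements. Given $\mathcal T$ and $\mathcal N$ (the paths having no subpath in $\mathcal T$): $\mathcal N_2$ is the set of paths of length $2$ in $\mathcal N$; for $t\in\mathcal T$, $\mathcal N_2(t)$ is the set of $n\in\mathcal N_2$ with $t\succ n$ and $n$ having the same start vertex and the same end vertex as $t$. Put $D=\sum_{t\in\mathcal T}|\mathcal N_2(t)|$ and $\mathcal A=K^D$, with points written $X=(x_{t,n})_{t\in\mathcal T,\,n\in\mathcal N_2(t)}$. For $X\in\mathcal A$, $\mathcal G(X)=\{g_t : t\in\mathcal T\}$ with $g_t=t-\sum_{n\in\mathcal N_2(t)}x_{t,n}n$. Finally $\mathrm{GrAlg}(\mathcal T)=\{X\in\mathcal A : KQ/\langle \mathcal G(X)\rangle$ is a strong Koszul algebra with respect to $\langle\mathcal G(X)\rangle$ and $\succ\}$. One writes $KQ/I\in\mathrm{GrAlg}(\mathcal T)$ if $I=\langle\mathcal G(X)\rangle$ for some $X\in \mathrm{GrAlg}(\mathcal T)$. *)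

(* Defs.v *)
From HB Require Import structures.
From mathcomp Require Import all_boot all_order all_algebra.
From mathcomp Require Import generic_quotient ring_quotient finmap.
From mathcomp.classical Require Import boolp classical_sets cardinality.

Set Implicit Arguments.
Unset Strict Implicit.
Unset Printing Implicit Defensive.

Import GRing.Theory.
Local Open Scope ring_scope.

Record quiver := Quiver {
  vertex : finType;
  arrow : finType;
  src : arrow -> vertex;
  tgt : arrow -> vertex }.

Section Paths.
Variable Q : quiver.

Fixpoint walk (v : vertex Q) (s : seq (arrow Q)) : bool :=
  if s is e :: s' then (src e == v) && walk (tgt e) s' else true.

(* A start vertex together with the list of arrows read from left to right;
   the list is empty exactly for the paths of length 0. *)
Record qpath := QPath {
  qpath_val : vertex Q * seq (arrow Q);
  _ : walk qpath_val.1 qpath_val.2 }.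

HB.instance Definition _ := [isSub for qpath_val].
HB.instance Definition _ := [Countable of qpath by <:].

Implicit Types p q r : qpath.

Definition pstart p : vertex Q := (val p).1.
Definition parrows p : seq (arrow Q) := (val p).2.
Definition pend p : vertex Q := last (pstart p) (map (@tgt Q) (parrows p)).
Definition plen p : nat := size (parrows p).

Definition pvertex (v : vertex Q) : qpath := @QPath (v, [::]) isT.

(* [None] stands for the zero product of two non-composable paths. *)
Definition pcat p q : option qpath :=
  if pend p == pstart q then insub (pstart p, parrows p ++ parrows q) else None.

Lemma walk_cat v s1 s2 :
  walk v (s1 ++ s2) = walk v s1 && walk (last v (map (@tgt Q) s1)) s2.
Proof. by elim: s1 v => //= e s IH v; rewrite IH andbA. Qed.

Lemma pcatE p q :
  omap val (pcat p q) =
  if pend p == pstart q then Some (pstart p, parrows p ++ parrows q) else None.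
Proof.
rewrite /pcat; case: eqP => //= pq; rewrite insubT //=.
by rewrite walk_cat (valP p) -/(pend p) pq (valP q).
Qed.

Lemma pcat_val p q r : pcat p q = Some r ->
  pend p = pstart q /\ val r = (pstart p, parrows p ++ parrows q).
Proof. by move=> pq; have := pcatE p q; rewrite pq; case: eqP => //= -> []. Qed.

Lemma pcat_start p q r : pcat p q = Some r -> pstart r = pstart p.
Proof. by case/pcat_val => _; rewrite /pstart => ->. Qed.

Lemma pcat_end p q r : pcat p q = Some r -> pend r = pend q.
Proof.
case/pcat_val => pq rE; rewrite /pend {1}/parrows {1}/pstart rE /=.
by rewrite map_cat last_cat -/(pend p) pq.
Qed.

Lemma pcatA p q r : obind (pcat p) (pcat q r) = obind (pcat^~ r) (pcat p q).
Proof.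
apply: (inj_omap val_inj).
case qrE: (pcat q r) => [s|]; case pqE: (pcat p q) => [t|] //=.
- have [[qr sE] [pq tE]] := (pcat_val qrE, pcat_val pqE).
  rewrite !pcatE (pcat_end pqE) (pcat_start qrE) pq qr !eqxx.
  by rewrite /parrows sE tE /pstart tE /= catA.
- have [qr sE] := pcat_val qrE.
  rewrite pcatE (pcat_start qrE).
  by have := pcatE p q; rewrite pqE; case: eqP.
- have [pq tE] := pcat_val pqE.
  rewrite pcatE (pcat_end pqE).
  by have := pcatE q r; rewrite qrE; case: eqP.
Qed.

Lemma pcat1p v p : pcat (pvertex v) p = if v == pstart p then Some p else None.
Proof.
apply: (inj_omap val_inj); rewrite pcatE /= /pend /=.
by case: eqP => //= ->; rewrite -surjective_pairing.
Qed.

Lemma pcatp1 p v : pcat p (pvertex v) = if pend p == v then Some p else None.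
Proof.
apply: (inj_omap val_inj); rewrite pcatE; case: eqP => //= _.
by rewrite cats0 -surjective_pairing.
Qed.

Definition paths2 : {fset qpath} := [fset p in
  pmap insub [seq (src ef.1, [:: ef.1; ef.2]) | ef : arrow Q * arrow Q]]%fset.

Lemma in_paths2 p : (p \in paths2) = (plen p == 2).
Proof.
rewrite !inE /= mem_pmap_sub.
apply/mapP/eqP => [[[e f] _ pE]|]; first by rewrite /plen /parrows pE.
case: p => [[v [|e [|f [|//]]]]] //= wp _; exists (e, f); rewrite ?mem_enum //=.
by congr (_, _); move: wp; case/andP => /eqP ->.
Qed.

End Paths.

(* The linear combinations of paths, given by their coefficients. *)
Definition pathalg (K : fieldType) (Q : quiver) : Type :=
  {fsfun qpath Q -> K with 0}.

HB.instance Definition _ (K : fieldType) (Q : quiver) :=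
  Choice.on (pathalg K Q).

(* The operations are locked because comparing terms by unfolding them is
   prohibitively slow. *)
HB.lock Definition path0 (K : fieldType) (Q : quiver) : pathalg K Q :=
  [fsfun p in fset0 => 0]%fset.

HB.lock Definition pathopp (K : fieldType) (Q : quiver) (x : pathalg K Q) :
  pathalg K Q := [fsfun p in finsupp x => - x p].

HB.lock Definition pathadd (K : fieldType) (Q : quiver) (x y : pathalg K Q) :
  pathalg K Q := [fsfun p in (finsupp x `|` finsupp y)%fset => x p + y p].

HB.lock Definition pathscale (K : fieldType) (Q : quiver) (a : K)
  (x : pathalg K Q) : pathalg K Q := [fsfun p in finsupp x => a * x p].

HB.lock Definition pelt (K : fieldType) (Q : quiver) (p : qpath Q) :
  pathalg K Q := [fsfun q in [fset p]%fset => 1].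

Section PathModule.
Variables (K : fieldType) (Q : quiver).
Local Notation KQ := (pathalg K Q).
Implicit Types (x y z : KQ) (p q : qpath Q) (a b : K).

Lemma path0E p : path0 K Q p = 0.
Proof. by rewrite path0.unlock fsfun_fun. Qed.

Lemma pathoppE x p : pathopp x p = - x p.
Proof. by rewrite pathopp.unlock fsfun_fun; case: finsuppP => //; rewrite oppr0. Qed.

Lemma pathaddE x y p : pathadd x y p = x p + y p.
Proof.
rewrite pathadd.unlock fsfun_fun in_fsetU.
by case: (finsuppP x); case: (finsuppP y); rewrite //= addr0.
Qed.

Lemma pathscaleE a x p : pathscale a x p = a * x p.
Proof. by rewrite pathscale.unlock fsfun_fun; case: finsuppP => //; rewrite mulr0. Qed.

Lemma peltE p q : pelt K p q = (q == p)%:R.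
Proof. by rewrite pelt.unlock fsfun_fun inE; case: eqP. Qed.

Lemma pathaddA : associative (@pathadd K Q).
Proof. by move=> x y z; apply/fsfunP => p; rewrite !pathaddE addrA. Qed.

Lemma pathaddC : commutative (@pathadd K Q).
Proof. by move=> x y; apply/fsfunP => p; rewrite !pathaddE addrC. Qed.

Lemma pathadd0 : left_id (path0 K Q) (@pathadd K Q).
Proof. by move=> x; apply/fsfunP => p; rewrite pathaddE path0E add0r. Qed.

Lemma pathaddN : left_inverse (path0 K Q) (@pathopp K Q) (@pathadd K Q).
Proof.
by move=> x; apply/fsfunP => p; rewrite pathaddE pathoppE path0E addNr.
Qed.

HB.instance Definition _ :=
  GRing.isZmodule.Build KQ pathaddA pathaddC pathadd0 pathaddN.

Lemma pathscaleA a b x : pathscale a (pathscale b x) = pathscale (a * b) x.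
Proof. by apply/fsfunP => p; rewrite !pathscaleE mulrA. Qed.

Lemma pathscale1 : left_id 1 (@pathscale K Q).
Proof. by move=> x; apply/fsfunP => p; rewrite pathscaleE mul1r. Qed.

Lemma pathscaleDr : right_distributive (@pathscale K Q) +%R.
Proof.
by move=> a x y; apply/fsfunP => p; rewrite pathscaleE !pathaddE !pathscaleE mulrDr.
Qed.

Lemma pathscaleDl x : {morph (@pathscale K Q)^~ x : a b / a + b}.
Proof.
by move=> a b; apply/fsfunP => p; rewrite pathaddE !pathscaleE mulrDl.
Qed.

HB.instance Definition _ := GRing.Zmodule_isLmodule.Build K KQ
  pathscaleA pathscale1 pathscaleDr pathscaleDl.

Lemma coef0 p : (0 : KQ) p = 0. Proof. exact: path0E. Qed.
Lemma coefN x p : (- x) p = - x p. Proof. exact: pathoppE. Qed.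
Lemma coefD x y p : (x + y) p = x p + y p. Proof. exact: pathaddE. Qed.
Lemma coefZ a x p : (a *: x) p = a * x p. Proof. exact: pathscaleE. Qed.

Lemma coef_sum I (r : seq I) (F : I -> KQ) p :
  (\sum_(i <- r) F i) p = \sum_(i <- r) F i p.
Proof.
exact: (big_morph (fun x : KQ => x p) (fun x y => coefD x y p) (coef0 p)).
Qed.

Lemma path_sumE x : x = \sum_(p <- finsupp x) x p *: pelt K p.
Proof.
apply/fsfunP => q; rewrite coef_sum.
have E p : (x p *: pelt K p) q = if p == q then x q else 0.
  by rewrite coefZ peltE eq_sym mulr_natr mulrb; case: eqP => // ->.
rewrite (eq_bigr _ (fun p _ => E p)); case: (finsuppP x q) => xq.
  by rewrite big1 // => p _; case: ifP.
rewrite (big_fsetD1 q) //= eqxx big1_fset ?addr0 // => p.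
by rewrite !inE => /andP[/negPf ->].
Qed.

End PathModule.

HB.lock Definition pathmul (K : fieldType) (Q : quiver) (x y : pathalg K Q) :
    pathalg K Q :=
  \sum_(p <- finsupp x) \sum_(q <- finsupp y)
     (x p * y q) *: oapp (@pelt K Q) 0 (pcat p q).

Section PathAlgebra.
Variables (K : fieldType) (Q : quiver).
Local Notation KQ := (pathalg K Q).

Local Notation pelt := (@pelt K Q).
Local Notation pathmul := (@pathmul K Q).

Implicit Types (x y z : KQ) (p q : qpath Q).

Definition pathone : KQ := \sum_(v : vertex Q) pelt (pvertex v).

Lemma pathmulEw (d1 d2 : {fset qpath Q}) x y :
  (finsupp x `<=` d1)%fset -> (finsupp y `<=` d2)%fset ->
  pathmul x y = \sum_(p <- d1) \sum_(q <- d2)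
     (x p * y q) *: oapp pelt 0 (pcat p q).
Proof.
move=> le_d1 le_d2; rewrite pathmul.unlock (big_fset_incl _ le_d1) /=; last first.
  by move=> p _ /fsfun_dflt xp; apply: big1 => q _; rewrite xp mul0r scale0r.
apply/eq_bigr => p _; apply/big_fset_incl => // q _ /fsfun_dflt ->.
by rewrite mulr0 scale0r.
Qed.

Lemma finsuppD x y : (finsupp (x + y)%R `<=` finsupp x `|` finsupp y)%fset.
Proof.
apply/fsubsetP => p; rewrite in_fsetU !mem_finsupp coefD.
by apply: contraNT; rewrite negb_or !negbK => /andP[/eqP -> /eqP ->]; rewrite addr0.
Qed.

Lemma finsuppZ a x : (finsupp (a *: x)%R `<=` finsupp x)%fset.
Proof.
apply/fsubsetP => p; rewrite !mem_finsupp coefZ.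
by apply: contraNN => /eqP ->; rewrite mulr0.
Qed.

Lemma finsupp_pelt p : finsupp (pelt p) = [fset p]%fset.
Proof.
by apply/fsetP => q; rewrite mem_finsupp peltE !inE; case: (q == p);
  rewrite ?oner_eq0 ?eqxx.
Qed.

Lemma finsupp_0 : finsupp (0 : KQ) = fset0.
Proof. by apply/fsetP => q; rewrite mem_finsupp coef0 eqxx inE. Qed.

Lemma pathmulDl : left_distributive pathmul +%R.
Proof.
move=> x y z; rewrite (pathmulEw (finsuppD x y) (fsubset_refl _)).
rewrite (pathmulEw (fsubsetUl _ (finsupp y)) (fsubset_refl _)).
rewrite (pathmulEw (fsubsetUr (finsupp x) _) (fsubset_refl _)).
rewrite -big_split /=; apply: eq_bigr => p _; rewrite -big_split /=.
by apply: eq_bigr => q _; rewrite coefD mulrDl scalerDl.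
Qed.

Lemma pathmulDr : right_distributive pathmul +%R.
Proof.
move=> z x y; rewrite (pathmulEw (fsubset_refl _) (finsuppD x y)).
rewrite (pathmulEw (fsubset_refl _) (fsubsetUl _ (finsupp y))).
rewrite (pathmulEw (fsubset_refl _) (fsubsetUr (finsupp x) _)).
rewrite -big_split /=; apply: eq_bigr => p _; rewrite -big_split /=.
by apply: eq_bigr => q _; rewrite coefD mulrDr scalerDl.
Qed.

Lemma pathmul0x : left_zero 0 pathmul.
Proof. by move=> x; rewrite pathmul.unlock finsupp_0 big_seq_fset0. Qed.

Lemma pathmulx0 : right_zero 0 pathmul.
Proof.
move=> x; rewrite pathmul.unlock finsupp_0.
by apply: big1 => p _; rewrite big_seq_fset0.
Qed.

Lemma pathmulZl a x y : pathmul (a *: x) y = a *: pathmul x y.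
Proof.
rewrite (pathmulEw (finsuppZ a x) (fsubset_refl _)) pathmul.unlock.
rewrite scaler_sumr; apply: eq_bigr => p _.
by rewrite scaler_sumr; apply: eq_bigr => q _; rewrite coefZ scalerA mulrA.
Qed.

Lemma pathmulZr a x y : pathmul x (a *: y) = a *: pathmul x y.
Proof.
rewrite (pathmulEw (fsubset_refl _) (finsuppZ a y)) pathmul.unlock.
rewrite scaler_sumr; apply: eq_bigr => p _.
by rewrite scaler_sumr; apply: eq_bigr => q _; rewrite coefZ scalerA mulrCA.
Qed.

Lemma pathmul_suml I (r : seq I) (F : I -> KQ) y :
  pathmul (\sum_(i <- r) F i) y = \sum_(i <- r) pathmul (F i) y.
Proof.
exact: (big_morph (pathmul^~ y) (fun x1 x2 => pathmulDl x1 x2 y) (pathmul0x y)).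
Qed.

Lemma pathmul_sumr I (r : seq I) (F : I -> KQ) x :
  pathmul x (\sum_(i <- r) F i) = \sum_(i <- r) pathmul x (F i).
Proof. exact: (big_morph (pathmul x) (pathmulDr x) (pathmulx0 x)). Qed.

Lemma pathmulU p q : pathmul (pelt p) (pelt q) = oapp pelt 0 (pcat p q).
Proof.
rewrite pathmul.unlock !finsupp_pelt !big_seq_fset1.
by rewrite !peltE !eqxx mulr1 scale1r.
Qed.

Lemma pathmul_ind (P : KQ -> Prop) :
  (forall x y, P x -> P y -> P (x + y)) -> P 0 ->
  (forall a x, P x -> P (a *: x)) -> (forall p, P (pelt p)) -> forall x, P x.
Proof.
move=> PD P0 PZ Pp x; rewrite [x]path_sumE.
by elim/big_ind: _ => // p _; apply: PZ.
Qed.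

Lemma pathmulA : associative pathmul.
Proof.
move=> x y z; elim/pathmul_ind: x => [x1 x2 IH1 IH2||a x IH|p].
- by rewrite !pathmulDl IH1 IH2.
- by rewrite !pathmul0x.
- by rewrite !pathmulZl IH.
elim/pathmul_ind: y => [y1 y2 IH1 IH2||a y IH|q].
- by rewrite !(pathmulDl, pathmulDr) IH1 IH2.
- by rewrite !(pathmul0x, pathmulx0).
- by rewrite !(pathmulZl, pathmulZr) IH.
elim/pathmul_ind: z => [z1 z2 IH1 IH2||a z IH|r].
- by rewrite !pathmulDr IH1 IH2.
- by rewrite !pathmulx0.
- by rewrite !pathmulZr IH.
rewrite !pathmulU; have := pcatA p q r.
case: (pcat q r) => [s|]; case: (pcat p q) => [t|] /=;
  rewrite ?pathmulU ?pathmulx0 ?pathmul0x //.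
- by move=> ->.
- by move=> ->.
- by move=> <-.
Qed.

Lemma pathmul1x : left_id pathone pathmul.
Proof.
elim/pathmul_ind => [x y IHx IHy||a x IH|p].
- by rewrite pathmulDr IHx IHy.
- by rewrite pathmulx0.
- by rewrite pathmulZr IH.
rewrite pathmul_suml (bigD1 (pstart p)) //= pathmulU pcat1p eqxx big1 ?addr0 //.
by move=> v /negPf vp; rewrite pathmulU pcat1p vp.
Qed.

Lemma pathmulx1 : right_id pathone pathmul.
Proof.
elim/pathmul_ind => [x y IHx IHy||a x IH|p].
- by rewrite pathmulDl IHx IHy.
- by rewrite pathmul0x.
- by rewrite pathmulZl IH.
rewrite pathmul_sumr (bigD1 (pend p)) //= pathmulU pcatp1 eqxx big1 ?addr0 //.
by move=> v /negPf vp; rewrite pathmulU pcatp1 eq_sym vp.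
Qed.

(* [pzRingType] and not [nzRingType]: the path algebra of the quiver without
   vertices is the zero ring. *)
HB.instance Definition _ := GRing.Zmodule_isPzRing.Build KQ
  pathmulA pathmul1x pathmulx1 pathmulDl pathmulDr.

End PathAlgebra.

Record ideal (R : pzRingType) := Ideal {
  ideal_set :> R -> Prop;
  ideal0 : ideal_set 0;
  idealD : forall x y, ideal_set x -> ideal_set y -> ideal_set (x + y);
  idealMl : forall a x, ideal_set x -> ideal_set (a * x);
  idealMr : forall x b, ideal_set x -> ideal_set (x * b) }.

Section IdealGen.
Variables (R : pzRingType) (X : set R).

Inductive ideal_span : R -> Prop :=
| IdealSpan_in x of X x : ideal_span x
| IdealSpan0 : ideal_span 0
| IdealSpanD x y of ideal_span x & ideal_span y : ideal_span (x + y)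
| IdealSpanMl a x of ideal_span x : ideal_span (a * x)
| IdealSpanMr x b of ideal_span x : ideal_span (x * b).

Definition ideal_gen : ideal R :=
  @Ideal R ideal_span IdealSpan0 IdealSpanD IdealSpanMl IdealSpanMr.

End IdealGen.

Section QuotientRing.
Variables (R : pzRingType) (I : ideal R).

Definition ideal_pred : {pred R} := fun x => `[< I x >].

Lemma ideal_pred_zmod : zmod_closed ideal_pred.
Proof.
split=> [|x y /asboolP Ix /asboolP Iy]; apply/asboolP; first exact: ideal0.
by rewrite -mulN1r; apply: idealD => //; apply: idealMl.
Qed.
HB.instance Definition _ :=
  GRing.isZmodClosed.Build R ideal_pred ideal_pred_zmod.

Definition quot_ring : Type := Quotient.quot ideal_pred.
HB.instance Definition _ := ZmodQuotient.on quot_ring.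
Local Notation RI := quot_ring.
Local Open Scope quotient_scope.

Lemma quot_eqP (x y : R) : \pi_RI x = \pi_RI y <-> I (x - y).
Proof.
split=> [/eqP|Ixy]; last apply/eqP.
  by rewrite -Quotient.idealrBE => /asboolP.
by rewrite -Quotient.idealrBE; apply/asboolP.
Qed.

End QuotientRing.

HB.lock Definition quot_one (R : pzRingType) (I : ideal R) : quot_ring I :=
  (\pi_(quot_ring I) 1)%qT.

HB.lock Definition quot_mul (R : pzRingType) (I : ideal R)
    (u v : quot_ring I) : quot_ring I :=
  (\pi_(quot_ring I) (repr u * repr v))%qT.

Section QuotientRingTheory.
Variables (R : pzRingType) (I : ideal R).
Local Notation RI := (quot_ring I).
Local Notation quot_one := (quot_one I).
Local Notation quot_mul := (@quot_mul R I).
Local Open Scope quotient_scope.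

Lemma quot_oneE : quot_one = \pi_RI 1.
Proof. by rewrite quot_one.unlock. Qed.

Lemma quot_mulE (x y : R) : quot_mul (\pi_RI x) (\pi_RI y) = \pi_RI (x * y).
Proof.
rewrite quot_mul.unlock; apply/quot_eqP.
set x' := repr (\pi_RI _); set y' := repr (\pi_RI _).
have -> : x' * y' - x * y = (x' - x) * y' + x * (y' - y).
  by rewrite mulrBl mulrBr addrA subrK.
by apply: idealD; [apply: idealMr|apply: idealMl]; apply/quot_eqP; rewrite reprK.
Qed.

Lemma quot_addE (x y : R) : \pi_RI x + \pi_RI y = \pi_RI (x + y).
Proof. by rewrite piE. Qed.

Lemma quot_mulA : associative quot_mul.
Proof.
by move=> u v w; rewrite -[u]reprK -[v]reprK -[w]reprK !quot_mulE mulrA.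
Qed.

Lemma quot_mul1 : left_id quot_one quot_mul.
Proof. by move=> u; rewrite -[u]reprK quot_oneE quot_mulE mul1r. Qed.

Lemma quot_mulx1 : right_id quot_one quot_mul.
Proof. by move=> u; rewrite -[u]reprK quot_oneE quot_mulE mulr1. Qed.

Lemma quot_mulDl : left_distributive quot_mul +%R.
Proof.
move=> u v w; rewrite -[u]reprK -[v]reprK -[w]reprK.
by rewrite quot_addE !quot_mulE quot_addE mulrDl.
Qed.

Lemma quot_mulDr : right_distributive quot_mul +%R.
Proof.
move=> u v w; rewrite -[u]reprK -[v]reprK -[w]reprK.
by rewrite quot_addE !quot_mulE quot_addE mulrDr.
Qed.

HB.instance Definition _ := GRing.Zmodule_isPzRing.Build RI
  quot_mulA quot_mul1 quot_mulx1 quot_mulDl quot_mulDr.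

End QuotientRingTheory.

Section Dimension.
Variable R : pzRingType.

Definition projective (P : lmodType R) : Prop :=
  forall (M N : lmodType R) (g : {linear M -> N}) (f : {linear P -> N}),
    (forall y, exists x, g x = y) ->
    exists h : {linear P -> M}, forall x, g (h x) = f x.

(* [M] has a projective resolution
   0 -> P n -> ... -> P 1 -> P 0 -> M -> 0, with differentials [d] and
   augmentation [eps]. *)
Definition pdim_le (M : lmodType R) (n : nat) : Prop :=
  exists (P : nat -> lmodType R) (d : forall i, {linear P i.+1 -> P i})
         (eps : {linear P 0%N -> M}),
    [/\ forall i, projective (P i),
        forall y, exists x, eps x = y,
        forall x, eps x = 0 <-> exists y, d 0%N y = x,
        forall i (x : P i.+1), d i x = 0 <-> exists y, d i.+1 y = x
      & forall i, (n < i)%N -> forall x : P i, x = 0].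

Definition gldim_le (n : nat) : Prop := forall M : lmodType R, pdim_le M n.

(* The supremum of the projective dimensions of all left modules, that is, the
   least [n] bounding them all; [None] stands for infinity. Right modules are
   the left modules over the converse ring [R^c]; over a finite-dimensional
   algebra both sides give the same value. *)
Definition gldim : option nat :=
  if pselect (exists n, `[< gldim_le n >]) is left bounded
  then Some (ex_minn bounded) else None.

End Dimension.

Section Koszul.
Variables (K : fieldType) (Q : quiver).
Local Notation KQ := (pathalg K Q).
Local Notation path := (qpath Q).

(* [gt p q] reads "p is larger than q". *)
Record length_admissible (gt : rel path) : Prop := LengthAdmissible {
  adm_irr : irreflexive gt;
  adm_trans : transitive gt;
  adm_total : forall p q, p != q -> gt p q || gt q p;
  adm_wf : well_founded (fun p q => gt q p);
  adm_mulr : forall p q r pr qr,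
    gt p q -> pcat p r = Some pr -> pcat q r = Some qr -> gt pr qr;
  adm_mull : forall p q s sp sq,
    gt p q -> pcat s p = Some sp -> pcat s q = Some sq -> gt sp sq;
  adm_sub : forall p q r t rq,
    pcat r q = Some rq -> pcat rq t = Some p -> p = q \/ gt p q;
  adm_len : forall p q, (plen q < plen p)%N -> gt p q }.

Variable gt : rel path.

Definition is_tip (x : KQ) (p : path) : Prop :=
  p \in finsupp x /\ forall q, q \in finsupp x -> q != p -> gt p q.

Definition tips (X : set KQ) : set path :=
  [set p | exists2 x, X x & is_tip x p]%classic.

Definition path_span (A : set path) : ideal KQ :=
  ideal_gen [set pelt K p | p in A]%classic.

Definition length_homogeneous (x : KQ) : Prop :=
  exists n, forall p, p \in finsupp x -> plen p = n.

Definition quadratic (x : KQ) : Prop :=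
  forall p, p \in finsupp x -> plen p = 2.

Definition uniform (x : KQ) : Prop :=
  x != 0 /\ exists v w, x = pelt K (pvertex v) * x * pelt K (pvertex w).

Definition graded (I : ideal KQ) : Prop :=
  exists2 X : set KQ, (forall x, X x -> length_homogeneous x) & I = ideal_gen X.

Definition groebner_basis (I : ideal KQ) (G : set KQ) : Prop :=
  [/\ (G `<=` I)%classic,
      forall g, G g -> length_homogeneous g /\ uniform g
    & path_span (tips G) = path_span (tips I)].

(* The property "KQ/I is a strong Koszul algebra with respect to I". *)
Definition strong_koszul (I : ideal KQ) : Prop :=
  graded I /\
  exists2 G : set KQ, groebner_basis I G & forall g, G g -> quadratic g.

Variable T : {fset path}.

Definition nontips : set path :=
  (~` tips (path_span [set t | t \in T]))%classic.

Definition nontips2 (t : path) : {fset path} :=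
  [fset n in paths2 Q | [&& `[< nontips n >], gt t n,
                            pstart n == pstart t & pend n == pend t]]%fset.

(* K^D, the coordinates being indexed by the pairs (t, n) with t in T and
   n in N_2(t). *)
Definition affine : Type := {ffun {t : T & nontips2 (val t)} -> K}.

Definition coord (X : affine) (t : T) (n : nontips2 (val t)) : K :=
  X (Tagged (fun t : T => nontips2 (val t)) n).

Definition gelt (X : affine) (t : T) : KQ :=
  pelt K (val t) - \sum_(n : nontips2 (val t)) coord X n *: pelt K (val n).

Definition gideal (X : affine) : ideal KQ := ideal_gen (range (gelt X)).

Definition GrAlg : set affine := [set X | strong_koszul (gideal X)]%classic.

(* The property "KQ/I belongs to GrAlg(T)". *)
Definition in_GrAlg (I : ideal KQ) : Prop := exists2 X, GrAlg X & I = gideal X.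

End Koszul.

(* Main.v *)
From HB Require Import structures.
From mathcomp Require Import all_boot all_order all_algebra finmap.
From mathcomp Require Import generic_quotient ring_quotient.
From mathcomp.classical Require Import boolp classical_sets cardinality.
Require Import Defs.

Set Implicit Arguments.
Unset Strict Implicit.
Unset Printing Implicit Defensive.

Import GRing.Theory.
Local Open Scope ring_scope.

(** The global dimension of an algebra [KQ/I] in [GrAlg T] is the largest
    length of a chain, a path all of whose subpaths of length 2 are in [T].
    This number does not mention [I], whence the theorem ([gldim_leP]).

    Because the [g_t] are a quadratic Groebner basis, the paths without subpath
    in [T], called normal here, form a basis of [KQ/I], and the normal form of a
    path only involves paths that are smaller and of the same length
    ([normal_forms_ex]). Nothing else about [I] is used afterwards.

    Let [S] be the algebra modulo its arrows. Over the monomial algebra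
    [KQ/<T>] the minimal resolution of [S] has in degree [k] the projective
    module with one generator for each chain of length [k], and the boundary of
    the generator of index [a c], with [a] an arrow, is [a] times the generator
    of index [c]. Anick's idea is that this resolution survives the passage to
    [KQ/I] if lower terms are added to the boundary. A basis element of the
    [k]-th term is a pair [(n, c)] of a normal path and a chain, and it is
    compared with the others through the product path [n c]. If [n a] is normal
    then the boundary sends [(n, a c)] to [(n a, c)] up to smaller terms; if it
    is not, then [n] ends with an arrow [b] such that [b a] is in [T], so that
    [b a c] is again a chain, and the pair is matched in the same way with a
    pair of the next term. Hence, one step after the other, the top terms of the
    [k]-th syzygy are the pairs [(n' a, c)] for which [a c] is a chain
    ([syzygy], [cover_step]).

    Length is a grading of the algebra, and a comparison of the shortest terms
    shows that the resolution is minimal ([step_rad]). A syzygy contained in the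
    radical is a direct summand only if it is zero ([cover_projective]), so that
    the projective dimension of [S] is at most [d] if and only if there is no
    chain of length [d + 1] ([cover_dim]).

    Finally, the projective dimension of [S] bounds that of all modules
    ([syz_ex_nilpotent]): as there are finitely many normal paths the radical is
    nilpotent, each layer of the socle series of a module is a retract of a
    direct sum of copies of [S], and the horseshoe lemma applies. *)


(** * Linear maps, submodules and quotient modules *)

Section LinearMaps.
Variables (R : pzRingType) (U V : lmodType R).

Definition Lin (f : U -> V) (fL : linear f) : {linear U -> V} :=
  HB.pack f (GRing.isLinear.Build R U V *:%R f fL).

End LinearMaps.

Section LinearMapFacts.
Variables (R : pzRingType).
Implicit Types U V W : lmodType R.

Lemma zero_linear U V : linear (fun _ : U => 0 : V).
Proof. by move=> a x y; rewrite scaler0 addr0. Qed.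
Definition lzero U V : {linear U -> V} := Lin (@zero_linear U V).

Lemma id_linear U : linear (@id U). Proof. by []. Qed.
Definition lid U : {linear U -> U} := Lin (@id_linear U).

Lemma comp_linear U V W (g : {linear V -> W}) (f : {linear U -> V}) :
  linear (fun x => g (f x)).
Proof. by move=> a x y; rewrite !linearP. Qed.
Definition lcomp U V W (g : {linear V -> W}) (f : {linear U -> V}) :
  {linear U -> W} := Lin (comp_linear g f).

Lemma add_linear U V (f g : {linear U -> V}) : linear (fun x => f x + g x).
Proof. by move=> a x y; rewrite !linearP scalerDr addrACA. Qed.
Definition ladd U V (f g : {linear U -> V}) : {linear U -> V} :=
  Lin (add_linear f g).

Lemma sub_linear U V (f g : {linear U -> V}) : linear (fun x => f x - g x).
Proof. by move=> a x y; rewrite !linearP scalerDr addrACA. Qed.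
Definition lsub U V (f g : {linear U -> V}) : {linear U -> V} :=
  Lin (sub_linear f g).

Lemma smul_linear V (v : V) : linear (fun a : R^o => (a : R) *: v).
Proof. by move=> a x y; rewrite scalerDl scalerA. Qed.
Definition lsmul V (v : V) : {linear R^o -> V} := Lin (smul_linear v).

(** This form of [linearZ] rewrites once the map is given, without inferring a
    scaling law. *)
Lemma lin_scale U V (f : {linear U -> V}) a u : f (a *: u) = a *: f u.
Proof. exact: linearZ. Qed.

(** Lifting through an injection is how a map into a kernel is produced,
    the kernel being given only up to isomorphism. *)
Lemma lift_inj U V W (i : {linear V -> W}) (f : {linear U -> W}) :
  injective i -> (forall x, exists y, i y = f x) ->
  exists h : {linear U -> V}, forall x, i (h x) = f x.
Proof.
move=> i_inj fi; have [h hE] := choice fi.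
have hL : linear h by move=> a x y; apply: i_inj; rewrite linearP !hE linearP.
by exists (Lin hL).
Qed.

End LinearMapFacts.

Record submod (R : pzRingType) (M : lmodType R) := Submod {
  submod_pred :> {pred M};
  submodP : submod_closed submod_pred }.

HB.instance Definition _ R M (A : @submod R M) :=
  GRing.isSubmodClosed.Build R M (submod_pred A) (submodP A).

Section Submodules.
Variables (R : pzRingType) (M : lmodType R) (A : submod M).

Definition sub_of : Type := {x : M | x \in submod_pred A}.
HB.instance Definition _ := SubChoice.on sub_of.
HB.instance Definition _ := [SubChoice_isSubLmodule of sub_of by <:].

Lemma sub_incl_linear : linear (val : sub_of -> M).
Proof. by move=> a x y; rewrite linearP. Qed.
Definition sub_incl : {linear sub_of -> M} := Lin sub_incl_linear.

Lemma sub_incl_inj : injective sub_incl. Proof. exact: val_inj. Qed.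

Lemma sub_inclP x : x \in submod_pred A <-> exists y, sub_incl y = x.
Proof. by split=> [Ax|[y <-]]; [exists (Sub x Ax)|apply: valP]. Qed.

Definition mquot : Type := Quotient.quot (submod_pred A).
HB.instance Definition _ := ZmodQuotient.on mquot.
Local Notation MA := mquot.

Lemma mquot_eqP (x y : M) :
  \pi_MA%qT x = \pi_MA%qT y <-> x - y \in submod_pred A.
Proof.
split=> [/eqP|Axy]; last apply/eqP.
  by rewrite -Quotient.idealrBE.
by rewrite -Quotient.idealrBE.
Qed.

Definition mquot_scale (a : R) (u : MA) : MA :=
  locked (\pi_MA%qT (a *: repr u)).

Lemma mquot_scaleE a x : mquot_scale a (\pi_MA%qT x) = \pi_MA%qT (a *: x).
Proof.
rewrite /mquot_scale -lock; apply/mquot_eqP; rewrite -scalerBr.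
by apply: rpredZ; apply/mquot_eqP/reprK.
Qed.

Lemma mquot_addE (x y : M) : \pi_MA%qT x + \pi_MA%qT y = \pi_MA%qT (x + y).
Proof. by rewrite piE. Qed.

Lemma mquot_scaleA a b u :
  mquot_scale a (mquot_scale b u) = mquot_scale (a * b) u.
Proof. by rewrite -[u]reprK !mquot_scaleE scalerA. Qed.

Lemma mquot_scale1 : left_id 1 mquot_scale.
Proof. by move=> u; rewrite -[u]reprK mquot_scaleE scale1r. Qed.

Lemma mquot_scaleDr : right_distributive mquot_scale +%R.
Proof.
move=> a u v; rewrite -[u]reprK -[v]reprK.
by rewrite mquot_addE !mquot_scaleE mquot_addE scalerDr.
Qed.

Lemma mquot_scaleDl u : {morph mquot_scale^~ u : a b / a + b}.
Proof.
by move=> a b; rewrite -[u]reprK !mquot_scaleE mquot_addE scalerDl.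
Qed.

HB.instance Definition _ := GRing.Zmodule_isLmodule.Build R MA
  mquot_scaleA mquot_scale1 mquot_scaleDr mquot_scaleDl.

Lemma mproj_linear : linear (fun x : M => \pi_MA%qT x : MA).
Proof. by move=> a x y; rewrite -mquot_addE -mquot_scaleE. Qed.
Definition mproj : {linear M -> MA} := Lin mproj_linear.

Lemma mproj_surj u : exists x, mproj x = u.
Proof. by exists (repr u); apply: reprK. Qed.

Lemma mproj_eq0 x : mproj x = 0 <-> x \in submod_pred A.
Proof.
by rewrite -{2}[x]subr0 -mquot_eqP -(raddf0 mproj).
Qed.

Lemma mquot_lift (N : lmodType R) (f : {linear M -> N}) :
  (forall x, x \in submod_pred A -> f x = 0) ->
  exists h : {linear mquot -> N}, forall x, h (mproj x) = f x.
Proof.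
move=> fA.
have fE x y : mproj x = mproj y -> f x = f y.
  by move=> /mquot_eqP /fA; rewrite linearB => /subr0_eq.
have rE (u : MA) : mproj (repr u) = u by apply: reprK.
have hL : linear (fun u : MA => f (repr u)).
  by move=> a u v; rewrite -linearP; apply: fE; rewrite linearP !rE.
by exists (Lin hL) => x; apply: fE; rewrite rE.
Qed.

End Submodules.

Section Kernels.
Variables (R : pzRingType).

Lemma submod_closed_asbool (M : lmodType R) (P : M -> Prop) :
  P 0 -> (forall a x y, P x -> P y -> P (a *: x + y)) ->
  submod_closed (fun x => `[< P x >]).
Proof.
move=> P0 PL; split=> [|a x y /asboolP Px /asboolP Py]; apply/asboolP => //.
exact: PL.
Qed.

Definition mksub (M : lmodType R) (P : M -> Prop) P0 PL : submod M :=
  Submod (@submod_closed_asbool M P P0 PL).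

Lemma mksubP (M : lmodType R) (P : M -> Prop) P0 PL x :
  x \in submod_pred (@mksub M P P0 PL) <-> P x.
Proof. by split=> /asboolP. Qed.

Lemma ker0 (M N : lmodType R) (f : {linear M -> N}) : f 0 = 0.
Proof. exact: raddf0. Qed.

Lemma kerL (M N : lmodType R) (f : {linear M -> N}) a x y :
  f x = 0 -> f y = 0 -> f (a *: x + y) = 0.
Proof. by rewrite linearP => -> ->; rewrite scaler0 addr0. Qed.

Definition ker (M N : lmodType R) (f : {linear M -> N}) : submod M :=
  mksub (ker0 f) (@kerL M N f).

Lemma kerP (M N : lmodType R) (f : {linear M -> N}) x :
  x \in submod_pred (ker f) <-> f x = 0.
Proof. exact: mksubP. Qed.

End Kernels.

(** * Direct powers *)

(** Finite support makes this the direct sum of the copies of [M], and not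
    their product. *)
Definition dpow (R : pzRingType) (J : choiceType) (M : lmodType R) : Type :=
  {fsfun J -> M with 0}.

HB.instance Definition _ R J M := Choice.on (@dpow R J M).

HB.lock Definition dpow0 (R : pzRingType) (J : choiceType) (M : lmodType R) :
  dpow J M := [fsfun j in fset0 => 0]%fset.

HB.lock Definition dpow_opp (R : pzRingType) (J : choiceType) (M : lmodType R)
  (x : dpow J M) : dpow J M := [fsfun j in finsupp x => - x j].

HB.lock Definition dpow_add (R : pzRingType) (J : choiceType) (M : lmodType R)
  (x y : dpow J M) : dpow J M :=
  [fsfun j in (finsupp x `|` finsupp y)%fset => x j + y j].

HB.lock Definition dpow_scale (R : pzRingType) (J : choiceType)
  (M : lmodType R) (a : R) (x : dpow J M) : dpow J M :=
  [fsfun j in finsupp x => a *: x j].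

HB.lock Definition single (R : pzRingType) (J : choiceType) (M : lmodType R)
  (j : J) (m : M) : dpow J M := [fsfun i in [fset j]%fset => m].

Section DirectPower.
Variables (R : pzRingType) (J : choiceType) (M : lmodType R).
Local Notation MJ := (dpow J M).
Implicit Types (x y : MJ) (j : J) (a : R).

Lemma dpow0E j : dpow0 J M j = 0.
Proof. by rewrite dpow0.unlock fsfun_fun. Qed.

Lemma dpow_oppE x j : dpow_opp x j = - x j.
Proof. by rewrite dpow_opp.unlock fsfun_fun; case: finsuppP => //; rewrite oppr0. Qed.

Lemma dpow_addE x y j : dpow_add x y j = x j + y j.
Proof.
rewrite dpow_add.unlock fsfun_fun in_fsetU.
by case: (finsuppP x); case: (finsuppP y); rewrite //= addr0.
Qed.

Lemma dpow_scaleE a x j : dpow_scale a x j = a *: x j.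
Proof.
by rewrite dpow_scale.unlock fsfun_fun; case: finsuppP => //; rewrite scaler0.
Qed.

Lemma singleE j (m : M) i : single j m i = if i == j then m else 0.
Proof. by rewrite single.unlock fsfun_fun inE. Qed.

Lemma dpow_addA : associative (@dpow_add R J M).
Proof. by move=> x y z; apply/fsfunP => j; rewrite !dpow_addE addrA. Qed.

Lemma dpow_addC : commutative (@dpow_add R J M).
Proof. by move=> x y; apply/fsfunP => j; rewrite !dpow_addE addrC. Qed.

Lemma dpow_add0 : left_id (dpow0 J M) (@dpow_add R J M).
Proof. by move=> x; apply/fsfunP => j; rewrite dpow_addE dpow0E add0r. Qed.

Lemma dpow_addN : left_inverse (dpow0 J M) (@dpow_opp R J M) (@dpow_add R J M).
Proof.
by move=> x; apply/fsfunP => j; rewrite dpow_addE dpow_oppE dpow0E addNr.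
Qed.

HB.instance Definition _ :=
  GRing.isZmodule.Build MJ dpow_addA dpow_addC dpow_add0 dpow_addN.

Lemma dpow_scaleA a b x : dpow_scale a (dpow_scale b x) = dpow_scale (a * b) x.
Proof. by apply/fsfunP => j; rewrite !dpow_scaleE scalerA. Qed.

Lemma dpow_scale1 : left_id 1 (@dpow_scale R J M).
Proof. by move=> x; apply/fsfunP => j; rewrite dpow_scaleE scale1r. Qed.

Lemma dpow_scaleDr : right_distributive (@dpow_scale R J M) +%R.
Proof.
move=> a x y; apply/fsfunP => j.
by rewrite dpow_scaleE !dpow_addE !dpow_scaleE scalerDr.
Qed.

Lemma dpow_scaleDl x : {morph (@dpow_scale R J M)^~ x : a b / a + b}.
Proof.
by move=> a b; apply/fsfunP => j; rewrite dpow_addE !dpow_scaleE scalerDl.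
Qed.

HB.instance Definition _ := GRing.Zmodule_isLmodule.Build R MJ
  dpow_scaleA dpow_scale1 dpow_scaleDr dpow_scaleDl.

Lemma dpow_coef0 j : (0 : MJ) j = 0. Proof. exact: dpow0E. Qed.
Lemma dpow_coefD x y j : (x + y) j = x j + y j. Proof. exact: dpow_addE. Qed.
Lemma dpow_coefZ a x j : (a *: x) j = a *: x j. Proof. exact: dpow_scaleE. Qed.

Lemma dpow_coef_linear j : linear (fun x : MJ => x j).
Proof. by move=> a x y; rewrite dpow_coefD dpow_coefZ. Qed.
Definition dcoef j : {linear MJ -> M} := Lin (dpow_coef_linear j).

Lemma single_linear j : linear (fun m : M => single j m).
Proof.
move=> a m n; apply/fsfunP => i; rewrite dpow_coefD dpow_coefZ !singleE.
by case: eqP; rewrite // scaler0 addr0.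
Qed.
Definition dsingle j : {linear M -> MJ} := Lin (single_linear j).

Lemma dpow_sumE x : x = \sum_(j <- finsupp x) single j (x j).
Proof.
apply/fsfunP => i; rewrite -[RHS]/(dcoef i _) raddf_sum /=.
have E j : single j (x j) i = if j == i then x i else 0.
  by rewrite singleE eq_sym; case: eqP => // ->.
rewrite (eq_bigr _ (fun j _ => E j)); case: (finsuppP x i) => xi.
  by rewrite big1 // => j _; case: ifP.
rewrite (big_fsetD1 i) //= eqxx big1_fset ?addr0 // => j.
by rewrite !inE => /andP[/negPf ->].
Qed.

End DirectPower.

Section DirectPowerMaps.
Variables (R : pzRingType) (J : choiceType).
Implicit Types M N : lmodType R.

Lemma dsum_fun_widen M N (h : J -> {linear M -> N}) (d : {fset J})
    (x : dpow J M) : (finsupp x `<=` d)%fset ->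
  \sum_(j <- finsupp x) h j (x j) = \sum_(j <- d) h j (x j).
Proof.
by move=> xd; apply: big_fset_incl => // j _ /fsfun_dflt ->; rewrite raddf0.
Qed.

(** The universal property of the direct sum. *)
Lemma dsum_linear M N (h : J -> {linear M -> N}) :
  linear (fun x : dpow J M => \sum_(j <- finsupp x) h j (x j)).
Proof.
move=> a x y.
pose d := (finsupp (x : dpow J M) `|` finsupp (y : dpow J M)
           `|` finsupp (a *: x + y : dpow J M)%R)%fset.
rewrite !(@dsum_fun_widen _ _ h d);
  try by apply/fsubsetP => j; rewrite !in_fsetU => ->; rewrite ?orbT.
rewrite scaler_sumr -big_split /=; apply: eq_bigr => j _.
by rewrite dpow_coefD dpow_coefZ linearP.
Qed.
Definition dsum M N (h : J -> {linear M -> N}) : {linear dpow J M -> N} :=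
  Lin (dsum_linear h).

Lemma dsum_single M N (h : J -> {linear M -> N}) j m :
  dsum h (single j m) = h j m.
Proof.
rewrite /= (@dsum_fun_widen _ _ h [fset j]%fset); last first.
  apply/fsubsetP => i; rewrite mem_finsupp singleE inE.
  by case: ifP => //; rewrite eqxx.
by rewrite big_seq_fset1 singleE eqxx.
Qed.

Lemma eq_dpow_linear M N (f g : {linear dpow J M -> N}) :
  (forall j m, f (single j m) = g (single j m)) -> forall x, f x = g x.
Proof.
by move=> fg x; rewrite [x]dpow_sumE !raddf_sum; apply: eq_bigr => j _; apply: fg.
Qed.

Definition dmap M N (h : {linear M -> N}) : {linear dpow J M -> dpow J N} :=
  dsum (fun j => lcomp (dsingle N j) h).

Lemma dmap_single M N (h : {linear M -> N}) j m :
  dmap h (single j m) = single j (h m).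
Proof. exact: dsum_single. Qed.

Lemma dmapE M N (h : {linear M -> N}) x j : dmap h x j = h (x j).
Proof.
rewrite -[LHS]/(lcomp (dcoef N j) (dmap h) x) -[RHS]/(lcomp h (dcoef M j) x).
apply: eq_dpow_linear => i m.
rewrite -[LHS]/(dmap h (single i m) j) -[RHS]/(h (single i m j)) dmap_single.
by rewrite !singleE; case: eqP; rewrite ?raddf0.
Qed.

End DirectPowerMaps.

(** * Projective dimension by syzygies *)

Section ProjectiveDimension.
Variable R : pzRingType.
Implicit Types L M N P : lmodType R.

Definition short_exact L P M (i : {linear L -> P}) (g : {linear P -> M}) :=
  [/\ injective i, forall y, exists x, g x = y
    & forall x, g x = 0 <-> exists y, i y = x].

Lemma ker_exact P M (g : {linear P -> M}) :
  (forall y, exists x, g x = y) -> short_exact (sub_incl (ker g)) g.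
Proof.
move=> g_surj; split=> // [|x]; first exact: sub_incl_inj.
by rewrite -kerP sub_inclP.
Qed.

Lemma projective_retract P M (f : {linear M -> P}) (g : {linear P -> M}) :
  (forall x, g (f x) = x) -> projective P -> projective M.
Proof.
move=> gf Pproj X Y p h p_surj.
have [u uE] := Pproj X Y p (lcomp h g) p_surj.
by exists (lcomp u f) => x; rewrite /= uE /= gf.
Qed.

Lemma projective_triv M : (forall x : M, x = 0) -> projective M.
Proof.
by move=> M0 X Y p f _; exists (lzero M X) => x; rewrite [x]M0 !raddf0.
Qed.

Lemma projective_regular : projective R^o.
Proof.
move=> X Y p f p_surj; have [x px] := p_surj (f 1).
exists (lsmul x) => a; rewrite -[f a]/(f (a : R^o)) /= linearZ /= px.
by rewrite -linearZ; congr (f _); apply: mulr1.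
Qed.

Lemma projective_dpow (J : choiceType) P :
  projective P -> projective (dpow J P).
Proof.
move=> Pproj X Y p f p_surj.
have hj j : exists h : {linear P -> X}, forall x, p (h x) = f (single j x).
  exact: (Pproj X Y p (lcomp f (dsingle P j)) p_surj).
have [h hE] := choice hj.
exists (dsum h) => x.
rewrite -[LHS]/(lcomp p (dsum h) x); apply: eq_dpow_linear => j m.
by rewrite -[LHS]/(p (dsum h (single j m))) dsum_single hE.
Qed.

Definition free_cover M : {linear dpow M R^o -> M} := dsum (@lsmul R M).

Lemma free_cover_surj M y : exists x, free_cover M x = y.
Proof.
by exists (@single R M R^o y 1); rewrite dsum_single /= scale1r.
Qed.

Lemma projective_free (J : choiceType) : projective (dpow J R^o).
Proof. exact/projective_dpow/projective_regular. Qed.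

(** A resolution of length [n] yields [syz_ex n M], while [syz_all n M] can be
    tested on a resolution of one's choice; they agree by Schanuel's lemma. *)
Fixpoint syz_ex n M : Prop :=
  if n is n'.+1 then
    exists P L (i : {linear L -> P}) (g : {linear P -> M}),
      [/\ projective P, short_exact i g & syz_ex n' L]
  else projective M.

Fixpoint syz_all n M : Prop :=
  if n is n'.+1 then
    forall P L (i : {linear L -> P}) (g : {linear P -> M}),
      projective P -> short_exact i g -> syz_all n' L
  else projective M.

(** This takes the place of stable isomorphism, as it passes to syzygies
    without direct sums. *)
Definition stable_retract M' M : Prop :=
  exists (P : lmodType R) (f : {linear M' -> M}) (g : {linear M -> M'})
         (al : {linear M' -> P}) (be : {linear P -> M'}),
    projective P /\ forall x, g (f x) - x = be (al x).

Lemma retract_stable M' M (f : {linear M' -> M}) (g : {linear M -> M'}) :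
  (forall x, g (f x) = x) -> stable_retract M' M.
Proof.
move=> gf; exists R^o, f, g, (lzero _ _), (lzero _ _); split=> [|x].
  exact: projective_regular.
by rewrite gf subrr.
Qed.

Lemma stable_retract_projective M' M :
  stable_retract M' M -> projective M -> projective M'.
Proof.
move=> [P [f [g [al [be [Pproj E]]]]]] Mproj X Y p h p_surj.
have [u uE] := Mproj X Y p (lcomp h g) p_surj.
have [w wE] := Pproj X Y p (lcomp h be) p_surj.
exists (lsub (lcomp u f) (lcomp w al)) => x.
by rewrite /= raddfB /= uE wE /= -E -raddfB /= opprB addrC subrK.
Qed.

(** Schanuel's lemma in terms of maps: lift both maps to the projective terms.
    The difference [D] of [r1 f1 - 1] and a lift of [be al g'] takes its values
    in [L'], and on [L'] it equals [r1 f1 - 1] because [g'] vanishes there. So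
    [r0 f0 - 1] extends to the projective [P']. *)
Lemma stable_retract_syzygy M' M P L P' L'
    (i : {linear L -> P}) (g : {linear P -> M})
    (i' : {linear L' -> P'}) (g' : {linear P' -> M'}) :
  projective P -> projective P' -> short_exact i g -> short_exact i' g' ->
  stable_retract M' M -> stable_retract L' L.
Proof.
move=> Pproj P'proj [i_inj g_surj gi] [i'_inj g'_surj gi'].
move=> [S [f [r [al [be [Sproj E]]]]]].
have [f1 f1E] := P'proj P M g (lcomp f g') g_surj.
have [r1 r1E] := Pproj P' M' g' (lcomp r g) g'_surj.
have [be1 be1E] := Sproj P' M' g' be g'_surj.
have [f0 f0E] : exists h : {linear L' -> L}, forall x, i (h x) = f1 (i' x).
  apply: (lift_inj (f := lcomp f1 i') i_inj) => x; apply/gi.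
  have -> : g (lcomp f1 i' x) = f (g' (i' x)) by rewrite /= f1E.
  by rewrite ((gi' _).2 _) ?raddf0 //; exists x.
have [r0 r0E] : exists h : {linear L -> L'}, forall x, i' (h x) = r1 (i x).
  apply: (lift_inj (f := lcomp r1 i) i'_inj) => x; apply/gi'.
  have -> : g' (lcomp r1 i x) = r (g (i x)) by rewrite /= r1E.
  by rewrite ((gi _).2 _) ?raddf0 //; exists x.
pose D := lsub (lsub (lcomp r1 f1) (lid P')) (lcomp be1 (lcomp al g')).
have [h hE] : exists h : {linear P' -> L'}, forall x, i' (h x) = D x.
  apply: (lift_inj (f := D) i'_inj) => x; apply/gi'.
  rewrite /D /= !raddfB /= r1E be1E /= f1E /= -E.
  by rewrite subrr.
exists P', f0, r0, i', h; split=> // x; apply: i'_inj.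
rewrite raddfB /= r0E f0E hE /D /=.
have -> : g' (i' x) = 0 by apply/gi'; exists x.
by rewrite (raddf0 al) (raddf0 be1) subr0.
Qed.

Lemma syz_ex_all n M M' : syz_ex n M -> stable_retract M' M -> syz_all n M'.
Proof.
elim: n M M' => [|n IH] M M' /=.
  by move=> Mproj MM'; apply: stable_retract_projective Mproj.
move=> [P [L [i [g [Pproj ig Ln]]]]] MM' P' L' i' g' P'proj ig'.
exact: IH Ln (stable_retract_syzygy Pproj P'proj ig ig' MM').
Qed.

Lemma syz_all_ex n M : syz_all n M -> syz_ex n M.
Proof.
elim: n M => [//|n IH] M /= Mn.
have fc := ker_exact (@free_cover_surj M).
exists (dpow M R^o), (sub_of (ker (free_cover M))),
  (sub_incl _), (free_cover M).
split=> //; first exact: projective_free.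
by apply: IH; apply: Mn fc => //; apply: projective_free.
Qed.

Lemma syz_ex_retract n M M' (f : {linear M' -> M}) (g : {linear M -> M'}) :
  (forall x, g (f x) = x) -> syz_ex n M -> syz_ex n M'.
Proof.
move=> gf Mn; apply: syz_all_ex.
by apply: (syz_ex_all Mn); apply: retract_stable gf.
Qed.

Lemma syz_ex_projective n M : projective M -> syz_ex n M.
Proof.
elim: n M => [//|n IH] M Mproj /=.
have id_surj (y : M) : exists x, lid M x = y by exists y.
exists M, (sub_of (ker (lid M))), (sub_incl _), (lid M).
split=> //; first exact: ker_exact.
apply: IH; apply: projective_triv => x; apply: sub_incl_inj.
by rewrite raddf0; apply/(kerP (lid M))/sub_inclP; exists x.
Qed.

Lemma syz_ex_dpow n (J : choiceType) M : syz_ex n M -> syz_ex n (dpow J M).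
Proof.
elim: n M => [|n IH] M /=; first exact: projective_dpow.
move=> [P [L [i [g [Pproj [i_inj g_surj gi] Ln]]]]].
exists (dpow J P), (dpow J L), (dmap J i), (dmap J g).
split; [exact: projective_dpow | split | exact: IH].
- move=> x y xy; apply/fsfunP => j; apply: i_inj.
  by rewrite -!dmapE xy.
- move=> y; have [s sE] := choice g_surj.
  exists (\sum_(j <- finsupp y) single j (s (y j))).
  rewrite raddf_sum [RHS]dpow_sumE; apply: eq_bigr => j _.
  by apply: etrans (dmap_single g j _) _; rewrite sE.
- move=> x; split=> [gx0|[y <-]]; last first.
    by apply/fsfunP => j; rewrite !dmapE dpow_coef0; apply/gi; exists (y j).
  have xj j : exists y, i y = x j.
    by apply/gi; rewrite -dmapE gx0 dpow_coef0.
  have [s sE] := choice xj.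
  exists (\sum_(j <- finsupp x) single j (s j)).
  rewrite raddf_sum [RHS]dpow_sumE; apply: eq_bigr => j _.
  by apply: etrans (dmap_single i j _) _; rewrite sE.
Qed.

(** The horseshoe lemma: the syzygy of [M] over the sum of the covers of [A]
    and [B] is an extension of the syzygies. *)
Lemma syz_ex_extension n (A M B : lmodType R)
    (j : {linear A -> M}) (p : {linear M -> B}) :
  short_exact j p -> syz_ex n A -> syz_ex n B -> syz_ex n M.
Proof.
elim: n A M B j p => [|n IH] A M B j p [j_inj p_surj pj].
  move=> Aproj Bproj X Y q f q_surj.
  have [s sE] := Bproj M B p (lid B) p_surj.
  have [u uE] := Aproj X Y q (lcomp f j) q_surj.
  have [w wE] := Bproj X Y q (lcomp f s) q_surj.
  have [r rE] : exists r : {linear M -> A}, forall x, j (r x) = x - s (p x).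
    apply: (lift_inj (f := lsub (lid M) (lcomp s p)) j_inj) => x.
    by apply/pj; rewrite /= raddfB /= sE subrr.
  exists (ladd (lcomp u r) (lcomp w p)) => x.
  by rewrite /= raddfD /= uE wE /= rE raddfB /= subrK.
move=> [PA [LA [iA [gA [PAp [iA_inj gA_surj gAi] LAn]]]]].
move=> [PB [LB [iB [gB [PBp [iB_inj gB_surj gBi] LBn]]]]].
have [s sE] := PBp M B p gB p_surj.
have gL : linear (fun x : (PA * PB)%type => j (gA x.1) + s x.2).
  by move=> a x y; rewrite !linearP /= scalerDr addrACA.
pose g : {linear (PA * PB)%type -> M} := Lin gL.
have gE (x : (PA * PB)%type) : g x = j (gA x.1) + s x.2 by [].
have pjA a : p (j a) = 0 by apply/pj; exists a.
have g_surj y : exists x, g x = y.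
  have [b bE] := gB_surj (p y).
  have [a aE] : exists a, j a = y - s b.
    by apply/pj; rewrite raddfB /= sE bE subrr.
  have [a' a'E] := gA_surj a.
  by exists (a', b); rewrite gE /= a'E aE subrK.
have PABproj : projective (PA * PB)%type.
  move=> X Y q f q_surj.
  have l1 : linear (fun a : PA => (a, 0) : (PA * PB)%type).
    by move=> c x y; congr pair; rewrite /= ?scaler0 ?addr0.
  have l2 : linear (fun b : PB => (0, b) : (PA * PB)%type).
    by move=> c x y; congr pair; rewrite /= ?scaler0 ?addr0.
  have [u uE] := PAp X Y q (lcomp f (Lin l1)) q_surj.
  have [w wE] := PBp X Y q (lcomp f (Lin l2)) q_surj.
  have hL : linear (fun x : (PA * PB)%type => u x.1 + w x.2).
    by move=> c x y; rewrite !linearP /= scalerDr addrACA.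
  exists (Lin hL) => -[a b] /=.
  rewrite raddfD /= uE wE /= -raddfD /=; congr (f _).
  by congr pair; rewrite /= ?addr0 ?add0r.
exists (PA * PB)%type, (sub_of (ker g)), (sub_incl _), g.
split=> //; first exact: ker_exact.
have kerE (y : sub_of (ker g)) : g (sub_incl _ y) = 0.
  by apply/(kerP g)/sub_inclP; exists y.
have [jL jLE] : exists h : {linear LA -> sub_of (ker g)},
    forall x, sub_incl (ker g) (h x) = (iA x, 0).
  have l1 : linear (fun a : LA => (iA a, 0) : (PA * PB)%type).
    by move=> c x y; congr pair; rewrite /= ?linearP ?scaler0 ?addr0.
  apply: (lift_inj (f := Lin l1)); first exact: sub_incl_inj.
  move=> x; apply/sub_inclP/kerP; rewrite gE /= raddf0 addr0.
  by rewrite ((gAi _).2 _) ?raddf0 //; exists x.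
have [pL pLE] : exists h : {linear sub_of (ker g) -> LB},
    forall x, iB (h x) = (sub_incl (ker g) x).2.
  have l2 : linear (fun x : sub_of (ker g) => (sub_incl (ker g) x).2).
    by move=> c x y; rewrite linearP.
  apply: (lift_inj (f := Lin l2)) => // x; apply/gBi.
  rewrite -sE; have := congr1 p (kerE x).
  by rewrite gE raddf0 raddfD /= pjA add0r.
apply: (IH _ _ _ jL pL _ LAn LBn); split.
- by move=> x y /(congr1 (sub_incl (ker g))); rewrite !jLE => -[] /iA_inj.
- move=> y; have ps : p (s (iB y)) = 0 by rewrite sE; apply/gBi; exists y.
  have [a aE] := (pj _).1 ps; have [a' a'E] := gA_surj a.
  have [x xE] : exists x, sub_incl (ker g) x = (- a', iB y).
    by apply/sub_inclP/kerP; rewrite gE /= !raddfN /= a'E aE addNr.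
  by exists x; apply: iB_inj; rewrite pLE xE.
- move=> x; split=> [px0|[y <-]]; last first.
    by apply: iB_inj; rewrite pLE jLE raddf0.
  have x2 : (sub_incl (ker g) x).2 = 0 by rewrite -pLE px0 raddf0.
  have := kerE x; rewrite gE x2 raddf0 addr0 => jx.
  have [a aE] : exists a, iA a = (sub_incl (ker g) x).1.
    by apply/gAi; apply: j_inj; rewrite jx raddf0.
  exists a; apply: sub_incl_inj; rewrite jLE aE -x2.
  by rewrite -surjective_pairing.
Qed.

Lemma syz_ex_pdim n M : syz_ex n M -> pdim_le M n.
Proof.
elim: n M => [|n IH] M /=.
  move=> Mproj; pose Z : lmodType R := sub_of (ker (lid M)).
  have Z0 (z : Z) : z = 0.
    apply: sub_incl_inj; rewrite raddf0.
    by apply/(kerP (lid M))/sub_inclP; exists z.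
  exists (fun i => if i is _.+1 then Z else M).
  exists (fun i => lzero _ _), (lid M).
  split.
  - by case=> [//|i]; apply: projective_triv.
  - by move=> y; exists y.
  - by move=> x; split=> [/= ->|[y <-]//]; exists 0.
  - by move=> [|i] x; split=> _ //; exists 0; rewrite [x]Z0.
  - by case.
move=> [P [L [i [g [Pproj [i_inj g_surj gi] /IH]]]]].
move=> [P' [d' [e' [P'proj e'_surj e'd' d'd' P'0]]]].
pose PP k : lmodType R := if k is k'.+1 then P' k' else P.
pose dd k : {linear PP k.+1 -> PP k} :=
  match k return {linear PP k.+1 -> PP k} with
  | 0%N => lcomp i e' | k'.+1 => d' k' end.
exists PP, dd, g.
split=> //; [by case|..].
- move=> x; split=> [/gi [y <-]|[y <-]]; last by apply/gi; exists (e' y).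
  by have [z <-] := e'_surj y; exists z.
- case=> [|k] x; last exact: d'd'.
  split=> [x0|x0]; last by rewrite -[LHS]/(i (e' x)) ((e'd' x).2 x0) raddf0.
  by apply/(e'd' x)/i_inj; rewrite raddf0.
- by case=> // k kn x; apply: P'0.
Qed.

Lemma pdim_syz_ex n M : pdim_le M n -> syz_ex n M.
Proof.
elim: n M => [|n IH] M [P [d [e [Pproj e_surj ed dd P0]]]] /=.
  have e_inj : injective e.
    move=> x y exy; apply/subr0_eq.
    have /ed [z <-] : e (x - y) = 0 by rewrite raddfB /= exy subrr.
    by rewrite [z]P0 ?raddf0.
  have [h hE] := lift_inj (f := lid M) e_inj e_surj.
  exact: (projective_retract (f := h) (g := e)).
exists (P 0%N), (sub_of (ker e)), (sub_incl _), e.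
split=> //; first exact: ker_exact.
have [e' e'E] : exists h : {linear P 1%N -> sub_of (ker e)},
    forall x, sub_incl (ker e) (h x) = d 0%N x.
  apply: (lift_inj (f := d 0%N)); first exact: sub_incl_inj.
  by move=> x; apply/sub_inclP/kerP/ed; exists x.
apply: IH; exists (fun k => P k.+1), (fun k => d k.+1), e'; split=> //.
- move=> y; have /ed [x xE] : e (sub_incl (ker e) y) = 0.
    by apply/(kerP e)/sub_inclP; exists y.
  by exists x; apply: sub_incl_inj; rewrite e'E.
- move=> x; rewrite -dd -e'E; split=> [->|]; rewrite ?raddf0 //.
  by rewrite -{1}(raddf0 (sub_incl (ker e))) => /sub_incl_inj.
- by move=> k kn x; apply: P0.
Qed.

End ProjectiveDimension.

(** * Splitting surjections over a field *)

(** A maximal partial section, given by its graph, is total. The field acts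
    through a ring morphism [ka], so that no second module structure is
    needed. *)
Lemma field_section (K : fieldType) (R : pzRingType) (ka : {rmorphism K -> R})
    (F M : lmodType R) (g : {linear F -> M}) :
  (forall y, exists x, g x = y) ->
  exists s : M -> F, [/\ forall x y, s (x + y) = s x + s y,
    forall a x, s (ka a *: x) = ka a *: s x & forall x, g (s x) = x].
Proof.
move=> g_surj.
pose P (A : set (M * F)%type) :=
  [/\ forall a x y, A x -> A y -> A (ka a *: x + y),
      forall x, A x -> g x.2 = x.1 & forall x, A x -> x.1 = 0 -> x.2 = 0].
have [A [[AL Ag A0] Amax]] : exists A, P A /\ forall B, (A `<` B)%classic -> ~ P B.
  apply: Zorn_bigcup => C CP Ctot; split.
  - move=> a x y [X CX Xx] [Y CY Yy].
    have [XY|YX] := Ctot X Y CX CY.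
      by exists Y => //; have [YL _ _] := CP Y CY; apply: YL => //; apply: XY.
    by exists X => //; have [XL _ _] := CP X CX; apply: XL => //; apply: YX.
  - by move=> x [X CX Xx]; have [_ Xg _] := CP X CX; apply: Xg.
  - by move=> x [X CX Xx]; have [_ _ X0] := CP X CX; apply: X0.
have A00 : A 0.
  have [[x Ax]|Aempty] := pselect (exists x, A x).
    have -> : 0 = ka (-1) *: x + x :> (M * F)%type.
      by rewrite rmorphN1 scaleN1r addNr.
    exact: AL.
  exfalso; apply: (Amax [set 0]%classic).
    by split=> [x Ax|/(_ 0 erefl) A00]; case: Aempty;
      [exists x | exists 0].
  split=> [a _ _ -> ->|x ->|x ->] //=; first by rewrite scaler0 addr0.
  by rewrite raddf0.
have Atot m : exists x, A (m, x).
  apply: contrapT => mA; have [x0 gx0] := g_surj m.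
  (* The graph spanned by [A] and one more point over [m]. *)
  pose B : set (M * F)%type :=
    [set x | exists a u, A u /\ x = ka a *: (m, x0) + u]%classic.
  apply: (Amax B).
    split=> [u Au|BA]; first by exists 0, u; rewrite rmorph0 scale0r add0r.
    apply: mA; exists x0; apply: BA; exists 1, 0.
    by rewrite rmorph1 scale1r addr0.
  split.
  - move=> a _ _ [b [u [Au ->]]] [c [v [Av ->]]].
    exists (a * b + c), (ka a *: u + v); split; first exact: AL.
    by rewrite scalerDr scalerA addrACA -scalerDl rmorphD rmorphM.
  - move=> _ [a [u [Au ->]]]; rewrite [RHS]/= -(Ag u Au) -gx0.
    by rewrite -[LHS]/(g (ka a *: x0 + u.2)) linearP.
  - move=> _ [a [u [Au ->]]]; rewrite [X in X = 0 -> _]/= => E.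
    have [a0|a0] := eqVneq a 0.
      move: E; rewrite a0 rmorph0 !scale0r !add0r => u1.
      exact: A0.
    exfalso; apply: mA; exists (ka (- a^-1) *: u + 0).2.
    suff -> : m = (ka (- a^-1) *: u + 0).1.
      by rewrite -surjective_pairing; apply: AL.
    have /(congr1 (fun z => ka a^-1 *: z)) := E.
    rewrite scaler0 scalerDr scalerA -rmorphM mulVf // rmorph1 scale1r.
    move=> /addr0_eq mE.
    by rewrite /= addr0 rmorphN scaleNr -mE opprK.
have [s sA] := choice Atot.
have suniq m x : A (m, x) -> x = s m.
  move=> Amx; apply/subr0_eq.
  have := A0 _ (AL (-1) _ _ (sA m) Amx).
  rewrite /= rmorphN1 !scaleN1r addNr => /(_ erefl) <-.
  by rewrite addrC.
exists s; split=> [x y|a x|x].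
- apply/esym/suniq; have := AL 1 _ _ (sA x) (sA y).
  by rewrite rmorph1 scale1r.
- apply/esym/suniq; have := AL a _ _ (sA x) A00.
  by rewrite addr0.
- exact: Ag (sA x).
Qed.

(** * Paths *)

Section PathFacts.
Variable Q : quiver.
Implicit Types p q r u : qpath Q.

Lemma qpath_eq p q : pstart p = pstart q -> parrows p = parrows q -> p = q.
Proof.
rewrite /pstart /parrows => ps pa; apply: val_inj.
by rewrite [val p]surjective_pairing ps pa -surjective_pairing.
Qed.

Lemma pcatP p q r : pcat p q = Some r <->
  [/\ pend p = pstart q, pstart r = pstart p
    & parrows r = parrows p ++ parrows q].
Proof.
split=> [/pcat_val[pq rE]|[pq rs ra]]; first by split; rewrite // /pstart /parrows rE.
apply: (inj_omap val_inj); rewrite pcatE pq eqxx /=; congr Some.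
by rewrite [RHS]surjective_pairing -rs -ra.
Qed.

Lemma pcat_ex p q : pend p = pstart q -> exists r, pcat p q = Some r.
Proof.
move=> pq; have := pcatE p q; rewrite pq eqxx.
by case: (pcat p q) => //= r _; exists r.
Qed.

Lemma plen_cat p q r : pcat p q = Some r -> plen r = (plen p + plen q)%N.
Proof. by move=> /pcatP[_ _ rE]; rewrite /plen rE size_cat. Qed.

Lemma plen0 p : plen p = 0%N -> p = pvertex (pstart p).
Proof. by move=> /size0nil pa; apply: qpath_eq. Qed.

Lemma pcat_inj p q p' q' r : plen q = plen q' ->
  pcat p q = Some r -> pcat p' q' = Some r -> p = p' /\ q = q'.
Proof.
move=> qq /pcatP[pq rs ra] /pcatP[pq' rs' ra'].
have sz : size (parrows p) = size (parrows p').
  apply/eqP; rewrite -(eqn_add2r (plen q)) {2}qq /plen -!size_cat.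
  by rewrite -ra -ra'.
move/eqP: (etrans (esym ra) ra'); rewrite eqseq_cat // => /andP[/eqP pa /eqP qa].
have pE : p = p' by apply: qpath_eq => //; rewrite -rs -rs'.
by split=> //; apply: qpath_eq => //; rewrite -pq -pq' pE.
Qed.

Lemma pcat_assocl p q r pq s : pcat p q = Some pq -> pcat pq r = Some s ->
  exists2 qr, pcat q r = Some qr & pcat p qr = Some s.
Proof.
move=> pqE sE; have := pcatA p q r; rewrite pqE /= sE.
by case: (pcat q r) => //= qr prE; exists qr.
Qed.

Lemma pcat_assocr p q r qr s : pcat q r = Some qr -> pcat p qr = Some s ->
  exists2 pq, pcat p q = Some pq & pcat pq r = Some s.
Proof.
move=> qrE sE; have := pcatA p q r; rewrite qrE /= sE.
by case: (pcat p q) => //= pq prE; exists pq.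
Qed.

Lemma psplit r s1 s2 : parrows r = s1 ++ s2 ->
  exists p q, [/\ pcat p q = Some r, parrows p = s1 & parrows q = s2].
Proof.
case: r => [[v s] w] /= sE; have sE' : s = s1 ++ s2 := sE.
have w' := w; rewrite /= sE' walk_cat in w'; case/andP: w' => w1 w2.
exists (@QPath _ (v, s1) w1), (@QPath _ (_, s2) w2); split=> //.
exact/pcatP.
Qed.

Lemma psplit_last r : (0 < plen r)%N ->
  exists p a, [/\ pcat p a = Some r, plen a = 1%N & (plen p).+1 = plen r].
Proof.
case/lastP rE: (parrows r) => [|s e]; first by rewrite /plen rE.
rewrite -cats1 in rE; have [p [a [rpa pE aE]]] := psplit rE.
move=> _; exists p, a; split; rewrite /plen ?aE //.
by rewrite rE pE size_cat addn1.
Qed.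

Lemma psplit_first r : (0 < plen r)%N ->
  exists a p, [/\ pcat a p = Some r, plen a = 1%N & (plen p).+1 = plen r].
Proof.
case rE: (parrows r) => [|e s]; first by rewrite /plen rE.
have [a [p [rap aE pE]]] := @psplit r [:: e] s rE.
by move=> _; exists a, p; split; rewrite /plen ?aE ?pE ?rE.
Qed.

End PathFacts.

Section Words.
Variables (Q : quiver) (T : {fset qpath Q}).
Hypothesis T2 : forall t, t \in T -> plen t = 2.
Implicit Types p q r u : qpath Q.

Definition rel2 (e f : arrow Q) : bool :=
  [exists t : T, parrows (val t) == [:: e; f]].

(** As [T] consists of paths of length 2, having no subpath in [T] is a
    condition on consecutive arrows. *)
Definition normal p : bool := sorted (fun e f => ~~ rel2 e f) (parrows p).

(** The paths all of whose subpaths of length 2 are in [T]; they index the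
    terms of the minimal resolution of the semisimple module. *)
Definition chain p : bool := sorted rel2 (parrows p).

Lemma not_sortedP (s : seq (arrow Q)) :
  ~~ sorted (fun e f => ~~ rel2 e f) s <->
  exists s1 e f s2, s = s1 ++ [:: e, f & s2] /\ rel2 e f.
Proof.
split=> [|[s1 [e [f [s2 [-> ef]]]]]].
  elim: s => [//|e [//|f s] IH] /=.
  rewrite negb_and negbK => /orP[ef|/IH [s1 [e' [f' [s2 [-> ef']]]]]].
    by exists [::], e, f, s.
  by exists (e :: s1), e', f', s2.
elim: s1 => [|e1 s1 IH] /=; first by rewrite ef.
by case: s1 IH => [|e2 s1] /= IH; [rewrite ef andbF | rewrite negb_and IH orbT].
Qed.

Lemma not_normalP p : ~~ normal p <->
  exists u t w ut, [/\ t \in T, pcat u t = Some ut & pcat ut w = Some p].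
Proof.
rewrite /normal not_sortedP.
split=> [[s1 [e [f [s2 [pE /existsP[t /eqP tE]]]]]]|].
  have [u [tw [utw uE twE]]] := psplit pE.
  have [t' [w [t'w t'E wE]]] := @psplit _ tw [:: e; f] s2 twE.
  have tt' : t' = val t.
    apply: qpath_eq; last by rewrite tE.
    have := valP (val t); have := valP t'.
    rewrite -!/(parrows _) -!/(pstart _) tE t'E /=.
    by move=> /andP[/eqP <- _] /andP[/eqP <- _].
  have [ut utE utwE] := pcat_assocr t'w utw.
  by exists u, t', w, ut; split=> //; rewrite tt'; apply: valP.
move=> [u [t [w [ut [Tt /pcatP[_ _ utE] /pcatP[_ _ pE]]]]]].
have := T2 Tt; case tE: (parrows t) => [|e [|f [|]]]; rewrite /plen tE // => _.
exists (parrows u), e, f, (parrows w); split.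
  by rewrite pE utE tE -catA.
by apply/existsP; exists [` Tt]%fset; rewrite tE.
Qed.

Lemma normal_arrow p : plen p = 1%N -> normal p.
Proof. by rewrite /plen /normal; case: (parrows p) => [|e []]. Qed.

Lemma not_normal_T t : t \in T -> ~~ normal t.
Proof.
move=> Tt; apply/not_normalP.
exists (pvertex (pstart t)), t, (pvertex (pend t)), t; split=> //.
  by rewrite pcat1p eqxx.
by rewrite pcatp1 eqxx.
Qed.

Lemma not_normal_cat p q r s rs : ~~ normal p ->
  pcat q p = Some r -> pcat r s = Some rs -> ~~ normal rs.
Proof.
move=> /not_sortedP [s1 [e [f [s2 [pE ef]]]]].
move=> /pcatP[_ _ rE] /pcatP[_ _ rsE].
apply/not_sortedP; exists (parrows q ++ s1), e, f, (s2 ++ parrows s).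
by rewrite rsE rE pE -!catA.
Qed.

Lemma normal_catl p q r : pcat p q = Some r -> normal r -> normal p.
Proof.
move=> pq; apply: contraLR => p_red.
have p1 : pcat (pvertex (pstart p)) p = Some p by rewrite pcat1p eqxx.
exact: not_normal_cat p_red p1 pq.
Qed.

(** As [T] consists of paths of length 2, the last two arrows are the only
    subpath of [n a] that can spoil normality. *)
Lemma normal_extend n a na : normal n -> plen a = 1%N -> pcat n a = Some na ->
  ~~ normal na ->
  exists n' b ba, [/\ pcat n' b = Some n, plen b = 1%N, pcat b a = Some ba
    & ~~ normal ba].
Proof.
move=> nn a1 naE nna; have := nna; rewrite /normal.
have /pcatP[na_end _ naa] := naE; rewrite naa.
case aE: (parrows a) a1 => [|e [|]]; rewrite /plen aE // => _.
case/lastP nE: (parrows n) => [//|s f].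
have n0 : (0 < plen n)%N by rewrite /plen nE size_rcons.
have [n' [b [n'b b1 _]]] := psplit_last n0.
have ba_end : pend b = pstart a by rewrite -na_end (pcat_end n'b).
have [ba baE] := pcat_ex ba_end.
have bE : parrows b = [:: f].
  have /pcatP[_ _ nE'] := n'b; move: nE'; rewrite nE.
  have := b1; rewrite /plen; case: (parrows b) => [|f' [|]] // _; rewrite cats1.
  by move=> /eqP; rewrite eqseq_rcons => /andP[_ /eqP ->].
move=> sE; exists n', b, ba; split=> //.
have /pcatP[_ _ baa] := baE; rewrite /normal baa bE aE /= andbT negbK.
move: nn; rewrite /normal nE; move: sE.
case: s {nE} => [|e0 s] /=; first by rewrite andbT negbK.
rewrite cat_path last_rcons /= => sE sn.
by move: sE; rewrite sn andbT negbK.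
Qed.

Lemma chain_arrow p : plen p = 1%N -> chain p.
Proof. by rewrite /plen /chain; case: (parrows p) => [|e []]. Qed.

(** With [normal_extend] this turns a pair whose product is not normal into an
    index of the next term of the resolution. *)
Lemma chain_cons b a c ac ba bac : plen b = 1%N -> plen a = 1%N ->
  pcat a c = Some ac -> pcat b a = Some ba -> pcat b ac = Some bac ->
  chain bac = ~~ normal ba && chain ac.
Proof.
move=> b1 a1 /pcatP[_ _ acE] /pcatP[_ _ baE] /pcatP[_ _ bacE].
rewrite /chain /normal bacE acE baE /plen in b1 a1 *.
case: (parrows b) b1 => [|f [|]] // _; case: (parrows a) a1 => [|e [|]] // _ /=.
by rewrite andbT negbK.
Qed.

End Words.

(** * Normal forms *)

HB.lock Definition cst_fun (K : fieldType) (Q : quiver) (a : K) :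
  pathalg K Q := a *: (1 : pathalg K Q).

Section PathAlgebraFacts.
Variables (K : fieldType) (Q : quiver).
Local Notation KQ := (pathalg K Q).
Implicit Types (x y z : KQ) (p q r u : qpath Q).

Lemma peltM p q : pelt K p * pelt K q = oapp (@pelt K Q) 0 (pcat p q).
Proof. exact: pathmulU. Qed.

Lemma scaleMl a x y : (a *: x) * y = a *: (x * y).
Proof. exact: pathmulZl. Qed.

Lemma scaleMr a x y : x * (a *: y) = a *: (x * y).
Proof. exact: pathmulZr. Qed.

Lemma one_sumE : 1 = \sum_(v : vertex Q) pelt K (pvertex v). Proof. by []. Qed.

Lemma cst_zmod : zmod_morphism (@cst_fun K Q).
Proof. by move=> a b; rewrite cst_fun.unlock scalerBl. Qed.

Lemma cst_monoid : monoid_morphism (@cst_fun K Q).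
Proof.
split=> [|a b]; first by rewrite cst_fun.unlock scale1r.
by rewrite cst_fun.unlock scaleMl mul1r scalerA.
Qed.

Definition cst : {rmorphism K -> KQ} :=
  HB.pack (@cst_fun K Q) (GRing.isZmodMorphism.Build K KQ _ cst_zmod)
    (GRing.isMonoidMorphism.Build K KQ _ cst_monoid).

Lemma cstM a x : cst a * x = a *: x.
Proof. by rewrite /= cst_fun.unlock scaleMl mul1r. Qed.

Lemma mulE x y : x * y = \sum_(p <- finsupp x) \sum_(q <- finsupp y)
     (x p * y q) *: (pelt K p * pelt K q).
Proof.
rewrite -[LHS]/(pathmul x y) pathmul.unlock; apply: eq_bigr => p _.
by apply: eq_bigr => q _; rewrite peltM.
Qed.

Lemma pelt_coef_neq0 p q : pelt K p q != 0 -> q = p.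
Proof. by rewrite peltE; case: (q =P p) => // _; rewrite eqxx. Qed.

Lemma sum_neq0 (V : nmodType) (I : Type) (s : seq I) (F : I -> V) :
  \sum_(i <- s) F i != 0 -> exists i, F i != 0.
Proof.
apply: contraPP => /forallNP F0; apply/negP; rewrite negbK.
by rewrite big1 // => i _; apply/eqP/negPn/negP/F0.
Qed.

Lemma mul_coef_neq0 x y r : (x * y) r != 0 ->
  exists p q, [/\ x p != 0, y q != 0 & pcat p q = Some r].
Proof.
rewrite mulE coef_sum => /sum_neq0 [p]; rewrite coef_sum => /sum_neq0 [q].
rewrite coefZ !mulf_eq0 !negb_or -andbA => /and3P[xp yq].
rewrite peltM; case pq: (pcat p q) => [s|] /=; last by rewrite coef0 eqxx.
by move=> /pelt_coef_neq0 ->; exists p, q.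
Qed.

Lemma vertex_mul_coef v x p :
  (pelt K (pvertex v) * x) p = if v == pstart p then x p else 0.
Proof.
elim/pathmul_ind: x => [x y IHx IHy||a x IH|q].
- by rewrite mulrDr !coefD IHx IHy; case: ifP; rewrite ?addr0.
- by rewrite mulr0 coef0; case: ifP.
- by rewrite scaleMr !coefZ IH; case: ifP; rewrite ?mulr0.
- rewrite peltM pcat1p; case: eqP => [vq|vq] /=; rewrite ?coef0 peltE.
    by case: (p =P q) => [->|_]; rewrite ?vq ?eqxx //; case: ifP.
  by case: (p =P q) => [->|_]; case: eqP.
Qed.

Lemma mul_vertex_coef v x p :
  (x * pelt K (pvertex v)) p = if pend p == v then x p else 0.
Proof.
elim/pathmul_ind: x => [x y IHx IHy||a x IH|q].
- by rewrite mulrDl !coefD IHx IHy; case: ifP; rewrite ?addr0.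
- by rewrite mul0r coef0; case: ifP.
- by rewrite scaleMl !coefZ IH; case: ifP; rewrite ?mulr0.
- rewrite peltM pcatp1; case: eqP => [vq|vq] /=; rewrite ?coef0 peltE.
    by case: (p =P q) => [->|_]; rewrite ?vq ?eqxx //; case: ifP.
  by case: (p =P q) => [->|_]; case: eqP.
Qed.

(** In the lowest degree only the vertices can multiply. *)
Lemma mul_lowest_coef (n : nat) x y p :
  (forall q, y q != 0 -> (n <= plen q)%N) -> plen p = n ->
  (x * y) p = x (pvertex (pstart p)) * y p.
Proof.
move=> yn pn; elim/pathmul_ind: x => [x z IHx IHz||a x IH|q].
- by rewrite mulrDl !coefD IHx IHz mulrDl.
- by rewrite mul0r !coef0 mul0r.
- by rewrite scaleMl !coefZ IH mulrA.
rewrite peltE; case: eqP => [<-|qp].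
  by rewrite vertex_mul_coef eqxx mul1r.
rewrite mul0r; apply/eqP/negPn/negP => /mul_coef_neq0 [r [s [/pelt_coef_neq0 ->]]].
move=> /yn ns qsp; have := plen_cat qsp; rewrite pn => nE.
case: qp; rewrite (pcat_start qsp).
apply/esym/plen0/eqP; rewrite -leqn0 -(leq_add2r n) add0n [X in (_ <= X)%N]nE.
by rewrite leq_add2l.
Qed.

Lemma mul_lowest_coefr (n : nat) x y p :
  (forall q, x q != 0 -> (n <= plen q)%N) -> plen p = n ->
  (x * y) p = x p * y (pvertex (pend p)).
Proof.
move=> xn pn; elim/pathmul_ind: y => [y z IHy IHz||a y IH|q].
- by rewrite mulrDr !coefD IHy IHz mulrDr.
- by rewrite mulr0 !coef0 mulr0.
- by rewrite scaleMr !coefZ IH mulrCA.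
rewrite peltE; case: eqP => [<-|qp].
  by rewrite mul_vertex_coef eqxx mulr1.
rewrite mulr0; apply/eqP/negPn/negP => /mul_coef_neq0 [r [s [xr /pelt_coef_neq0 ->]]].
move: xr => /xn nr rqp; have := plen_cat rqp; rewrite pn => nE.
case: qp; have q0 : plen q = 0%N.
  apply/eqP; rewrite -leqn0 -(leq_add2l n) addn0 [X in (_ <= X)%N]nE.
  by rewrite leq_add2r.
by rewrite (pcat_end rqp) (plen0 q0).
Qed.

Lemma monomial_ideal_supp (P : pred (qpath Q)) (A : set (qpath Q)) x :
  (forall p q r u ru, P p -> pcat q p = Some r -> pcat r u = Some ru -> P ru) ->
  (forall p, A p -> P p) -> path_span K A x -> forall p, x p != 0 -> P p.
Proof.
move=> Pcat AP; elim=> {x} [_ [p Ap <-]||x y _ IHx _ IHy|a x _ IH|x b _ IH] q.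
- by move=> /pelt_coef_neq0 ->; apply: AP.
- by rewrite coef0 eqxx.
- have [x0|x0] := eqVneq (x q) 0; last by move=> _; apply: IHx.
  by rewrite coefD x0 add0r; apply: IHy.
- move=> /mul_coef_neq0 [p [r [_ /IH Pp pr]]].
  by apply: (Pcat _ _ _ (pvertex (pend q)) _ Pp pr); rewrite pcatp1 eqxx.
- move=> /mul_coef_neq0 [p [r [/IH Pp _ pr]]].
  by apply: (Pcat _ (pvertex (pstart p)) p _ _ Pp _ pr); rewrite pcat1p eqxx.
Qed.

End PathAlgebraFacts.

Arguments cst {K} Q.

Section AdmissibleOrder.
Variables (Q : quiver) (gt : rel (qpath Q)).
Hypothesis adm : length_admissible gt.
Implicit Types p q r u m : qpath Q.

Definition ple p q : Prop := p = q \/ gt q p.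

Lemma gt_asym p q : gt p q -> gt q p -> False.
Proof. by move=> pq qp; have := adm_trans adm pq qp; rewrite (adm_irr adm). Qed.

Lemma ple_gt_false p q : ple p q -> gt p q -> False.
Proof. by case=> [->|qp]; [rewrite (adm_irr adm)|apply: gt_asym]. Qed.

Lemma ple_trans p q r : ple p q -> ple q r -> ple p r.
Proof.
case=> [->//|qp] [<-|rq]; right => //; exact: adm_trans adm _ _ _ rq qp.
Qed.

Lemma ple_lt_trans p q r : ple p q -> gt r q -> gt r p.
Proof. by case=> [->//|qp] rq; exact: adm_trans adm _ _ _ rq qp. Qed.

Lemma lt_ple_trans p q r : gt q p -> ple q r -> gt r p.
Proof. by move=> qp [<-//|rq]; exact: adm_trans adm _ _ _ rq qp. Qed.

Lemma ple_mulr p q r pr qr : ple p q -> pcat p r = Some pr ->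
  pcat q r = Some qr -> ple pr qr.
Proof.
case=> [->|qp]; first by move=> -> [->]; left.
by move=> E1 E2; right; apply: adm_mulr adm _ _ _ _ _ qp E2 E1.
Qed.

Lemma ple_mull p q r rp rq : ple p q -> pcat r p = Some rp ->
  pcat r q = Some rq -> ple rp rq.
Proof.
case=> [->|qp]; first by move=> -> [->]; left.
by move=> E1 E2; right; apply: adm_mull adm _ _ _ _ _ qp E2 E1.
Qed.

Lemma ple_total p q : ple p q \/ gt p q.
Proof.
have [->|pq] := eqVneq p q; first by left; left.
by have /orP[] := adm_total adm pq; [right|left; right].
Qed.

Lemma path_max (s : seq (qpath Q)) : s != [::] ->
  exists2 m, m \in s & forall q, q \in s -> ple q m.
Proof.
elim: s => // p [|q s] IH _.
  by exists p; [rewrite inE|move=> q; rewrite inE => /eqP ->; left].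
have [//|m ms mmax] := IH; case: (ple_total p m) => [pm|pm].
  exists m; first by rewrite inE ms orbT.
  by move=> r; rewrite inE => /orP[/eqP -> //|/mmax].
exists p; first by rewrite inE eqxx.
move=> r; rewrite inE => /orP[/eqP ->|/mmax rm]; first by left.
by right; apply: ple_lt_trans rm pm.
Qed.

End AdmissibleOrder.

Section NormalForms.
Variables (K : fieldType) (Q : quiver) (gt : rel (qpath Q)).
Variable T : {fset qpath Q}.
Hypothesis adm : length_admissible gt.
Hypothesis T2 : forall t, t \in T -> plen t = 2.
Local Notation KQ := (pathalg K Q).
Implicit Types (x y z : KQ) (p q r u : qpath Q).

Lemma is_tip_ex x : x != 0 -> exists p, is_tip gt x p.
Proof.
move=> x0; have s0 : enum_fset (finsupp x) != [::].
  apply: contra_neq x0 => s0; apply/fsfunP => p; rewrite coef0.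
  apply: fsfun_dflt; rewrite -[_ \in _]/(p \in enum_fset (finsupp x)) s0.
  by rewrite in_nil.
have [m ms mmax] := path_max adm s0; exists m; split=> // q qs qm.
by case: (mmax q qs) => // qE; rewrite qE eqxx in qm.
Qed.

Lemma nontipsP p : nontips K gt T p <-> normal T p.
Proof.
split=> [pN|p_norm [x xT [px _]]]; last first.
  move: p_norm; apply/negP; apply: (monomial_ideal_supp (P := fun p => ~~ normal T p) _ _ xT).
  - by move=> q r u v w; apply: not_normal_cat.
  - by move=> t Tt; apply: not_normal_T.
  - by rewrite -mem_finsupp.
apply: contraPT pN => /(not_normalP T2) [u [t [w [ut [Tt utE pE]]]]] pN.
apply: pN; exists (pelt K p); last first.
  split; first by rewrite finsupp_pelt inE.
  by move=> q; rewrite finsupp_pelt inE => /eqP ->; rewrite eqxx.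
have -> : pelt K p = pelt K u * pelt K t * pelt K w.
  by rewrite peltM utE /= peltM pE.
by apply/IdealSpanMr/IdealSpanMl/IdealSpan_in; exists t.
Qed.

Variable X : affine K gt T.
Hypothesis XG : GrAlg X.

Lemma gelt_coef t p : gelt X t p = (p == val t)%:R -
  \sum_(n : nontips2 K gt T (val t)) coord X n * (p == val n)%:R.
Proof.
rewrite /gelt coefD coefN peltE coef_sum; congr (_ - _).
by apply: eq_bigr => n _; rewrite coefZ peltE.
Qed.

Lemma nontips2P t n : n \in nontips2 K gt T t <->
  [/\ plen n = 2, normal T n, gt t n, pstart n = pstart t & pend n = pend t].
Proof.
have -> : (n \in nontips2 K gt T t) = (n \in paths2 Q) &&
    [&& `[< nontips K gt T n >], gt t n, pstart n == pstart t & pend n == pend t].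
  by rewrite inE.
rewrite in_paths2; split.
  by move=> /and5P[/eqP n2 /asboolP/nontipsP nn tn /eqP sn /eqP en].
by move=> [-> /nontipsP nn -> -> ->]; rewrite !eqxx /= andbT; apply/asboolP.
Qed.

Lemma gelt_supp (t : T) p : gelt X t p != 0 ->
  p = val t \/ p \in nontips2 K gt T (val t).
Proof.
rewrite gelt_coef; case: (p =P val t) => [->|pt]; first by left.
rewrite add0r oppr_eq0 => /sum_neq0 [n].
rewrite mulf_eq0 negb_or => /andP[_]; case: (p =P val n) => [-> _|_].
  by right; apply: valP.
by rewrite eqxx.
Qed.

Lemma gelt_uniform (t : T) p : gelt X t p != 0 ->
  [/\ plen p = 2, pstart p = pstart (val t) & pend p = pend (val t)].
Proof.
case/gelt_supp => [->|/nontips2P []//]; split=> //.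
by apply: T2; apply: valP.
Qed.

Lemma gelt_T (t u : T) : gelt X t (val u) = (u == t)%:R.
Proof.
rewrite gelt_coef (inj_eq val_inj); have [->|_] := eqVneq u t.
  rewrite big1 ?subr0 // => n _.
  have /nontips2P[_ _ tn _ _] := valP n.
  case: eqP => [tE|_]; last by rewrite mulr0.
  by rewrite -tE (adm_irr adm) in tn.
rewrite big1 ?subr0 // => n _; case: eqP => [uE|_]; last by rewrite mulr0.
have /nontips2P[_ nn _ _ _] := valP n.
by have := not_normal_T T2 (valP u); rewrite uE nn.
Qed.

Definition degree2_span x : Prop :=
  (forall p, x p != 0 -> (2 <= plen p)%N) /\
  exists al : T -> K, forall p, plen p = 2 -> x p = \sum_t al t * gelt X t p.

(** The generators have degree 2 and are uniform: multiplication by paths of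
    positive length leaves degree 2, and by vertices it rescales them. *)
Lemma ideal_degree2 x : gideal X x -> degree2_span x.
Proof.
elim=> {x} [_ [t _ <-]||x y _ [x2 [al alE]] _ [y2 [be beE]]
           |a x _ [x2 [al alE]]|x b _ [x2 [al alE]]].
- split=> [p /gelt_uniform[-> //]|]; exists (fun u : T => (u == t)%:R) => p _.
  rewrite (bigD1 t) //= eqxx mul1r big1 ?addr0 // => u /negPf ->.
  by rewrite mul0r.
- split=> [p|]; first by rewrite coef0 eqxx.
  by exists (fun _ => 0) => p _; rewrite coef0 big1 // => t _; rewrite mul0r.
- split=> [p|].
    by rewrite coefD; have [->|/x2//] := eqVneq (x p) 0; rewrite add0r => /y2.
  exists (fun t => al t + be t) => p p2; rewrite coefD alE // beE //.
  by rewrite -big_split; apply: eq_bigr => t _; rewrite mulrDl.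
- split=> [p /mul_coef_neq0 [q [r [_ /x2 r2 pE]]]|].
    by rewrite (plen_cat pE) (leq_trans r2) ?leq_addl.
  exists (fun t => a (pvertex (pstart (val t))) * al t) => p p2.
  rewrite (mul_lowest_coef _ x2 p2) alE // mulr_sumr; apply: eq_bigr => t _.
  have [->|/gelt_uniform[_ -> _]] := eqVneq (gelt X t p) 0.
    by rewrite !mulr0.
  by rewrite mulrA.
- split=> [p /mul_coef_neq0 [q [r [/x2 r2 _ pE]]]|].
    by rewrite (plen_cat pE) (leq_trans r2) ?leq_addr.
  exists (fun t => al t * b (pvertex (pend (val t)))) => p p2.
  rewrite (mul_lowest_coefr _ x2 p2) alE // mulr_suml; apply: eq_bigr => t _.
  have [->|/gelt_uniform[_ _ ->]] := eqVneq (gelt X t p) 0.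
    by rewrite !mulr0 mul0r.
  by rewrite mulrAC.
Qed.

(** In degree 2 the ideal is spanned by the [g_t]. A tip outside [T] would occur
    in some [g_t] with nonzero coefficient, where it is smaller than [t]; but
    [t] occurs in no other generator and is not cancelled. *)
Lemma quadratic_tip x p : gideal X x -> quadratic x -> is_tip gt x p -> p \in T.
Proof.
move=> /ideal_degree2[_ [al alE]] x2 [px ptip].
have p2 := x2 p px; have := px; rewrite mem_finsupp alE //.
move=> /sum_neq0 [t]; rewrite mulf_eq0 negb_or => /andP[alt /gelt_supp].
case=> [->|/nontips2P[_ _ tp _ _]]; first exact: valP.
have xt : x (val t) = al t.
  rewrite alE; last by apply: T2; apply: valP.
  rewrite (bigD1 t) //= gelt_T eqxx mulr1 big1 ?addr0 // => u /negPf ut.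
  by rewrite gelt_T eq_sym ut mulr0.
have tp' : val t != p.
  by apply/eqP => tE; rewrite tE (adm_irr adm) in tp.
have := ptip (val t); rewrite mem_finsupp xt => /(_ alt tp') pt.
by case: (gt_asym adm tp pt).
Qed.

(** The Groebner basis makes every tip of the ideal a multiple of an element
    of [T]. *)
Lemma normal_independent x : gideal X x ->
  (forall p, x p != 0 -> normal T p) -> x = 0.
Proof.
move=> Ix xn; apply/eqP/negPn/negP => /is_tip_ex [p xp].
have [_ [G [GI _ GE] G2]] := XG.
have px : path_span K (tips gt (gideal X)) (pelt K p).
  by apply: IdealSpan_in; exists p => //; exists x.
rewrite -GE in px.
have /xn : x p != 0 by rewrite -mem_finsupp; case: xp.
apply/negP; apply: (monomial_ideal_supp (P := fun p => ~~ normal T p) _ _ px).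
- by move=> q r u v w; apply: not_normal_cat.
- move=> t [g Gg gt_]; apply: not_normal_T => //.
  by apply: quadratic_tip gt_; [apply: GI|apply: G2].
- by rewrite peltE eqxx oner_eq0.
Qed.


Local Notation L := (quot_ring (gideal X)).
Local Open Scope quotient_scope.

Lemma qm_zmod : zmod_morphism (fun x : KQ => \pi_L x).
Proof. by move=> x y; rewrite piE. Qed.

Lemma qm_monoid : monoid_morphism (fun x : KQ => \pi_L x).
Proof.
by split=> [|x y]; apply/esym; [apply: quot_oneE|apply: quot_mulE].
Qed.

Definition qm : {rmorphism KQ -> L} :=
  HB.pack (fun x : KQ => \pi_L x : L)
    (GRing.isZmodMorphism.Build KQ L _ qm_zmod)
    (GRing.isMonoidMorphism.Build KQ L _ qm_monoid).

Lemma qm_eqP x y : qm x = qm y <-> gideal X (x - y).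
Proof. exact: quot_eqP. Qed.

Lemma qmZ a x : qm (a *: x) = qm (cst Q a) * qm x.
Proof. by rewrite -rmorphM cstM. Qed.

Definition reduced p x : Prop := forall n, x n != 0 ->
  [/\ normal T n, ple gt n p, plen n = plen p, pstart n = pstart p
    & pend n = pend p].

Lemma reducedD p x y : reduced p x -> reduced p y -> reduced p (x + y).
Proof.
move=> xp yp n; rewrite coefD; have [->|/xp//] := eqVneq (x n) 0.
by rewrite add0r; apply: yp.
Qed.

Lemma reducedZ p a x : reduced p x -> reduced p (a *: x).
Proof. by move=> xp n; rewrite coefZ mulf_eq0 negb_or => /andP[_ /xp]. Qed.

(** Replacing a subpath [t] in [T] by [t - g_t] only creates smaller paths, and
    the order is well-founded. *)
Lemma path_reduction p : exists2 x, qm x = qm (pelt K p) & reduced p x.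
Proof.
elim/(well_founded_induction (adm_wf adm)): p => p IH.
have [pn|] := boolP (normal T p).
  by exists (pelt K p) => // n /pelt_coef_neq0 ->; split=> //; left.
move=> /(not_normalP T2) [u [t [w [ut [Tt utE pE]]]]].
pose t' : T := [` Tt]%fset.
pose y := \sum_(n : nontips2 K gt T t)
  coord X (n : nontips2 K gt T (val t')) *: (pelt K u * pelt K (val n) * pelt K w).
have yE : qm (pelt K p) = qm y.
  apply/qm_eqP; suff -> : pelt K p - y = pelt K u * gelt X t' * pelt K w.
    by apply/IdealSpanMr/IdealSpanMl/IdealSpan_in; exists t'.
  rewrite /gelt mulrBr mulrBl peltM utE /= peltM pE /=; congr (_ - _).
  rewrite mulr_sumr mulr_suml; apply: eq_bigr => n _.
  by rewrite scaleMr scaleMl.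
rewrite yE; elim/big_ind: (y) => [|y1 y2 [x1 E1 R1] [x2 E2 R2]|n _].
- by exists 0 => // n; rewrite coef0 eqxx.
- by exists (x1 + x2); [rewrite !rmorphD E1 E2|apply: reducedD].
have /nontips2P[n2 nn tn sn en] := valP n.
have /pcatP[ut_end _ _] := utE; have /pcatP[w_start _ _] := pE.
have [un unE] : exists r, pcat u (val n) = Some r.
  by apply: pcat_ex; rewrite sn.
have [unw unwE] : exists r, pcat un w = Some r.
  by apply: pcat_ex; rewrite (pcat_end unE) en -(pcat_end utE).
have lt_p : gt p unw.
  exact: adm_mulr adm _ _ _ _ _ (adm_mull adm tn utE unE) pE unwE.
have [x xE xR] := IH unw lt_p; exists (coord X (n : nontips2 K gt T (val t')) *: x).
  by rewrite peltM unE /= peltM unwE /= (qmZ _ x) xE -qmZ.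
apply: reducedZ => m /xR[mn mp ml ms me]; split=> //.
- by right; apply: ple_lt_trans lt_p.
- rewrite ml (plen_cat unwE) (plen_cat unE) (plen_cat pE) (plen_cat utE).
  by rewrite n2 (T2 Tt).
- by rewrite ms (pcat_start unwE) (pcat_start unE) (pcat_start pE) (pcat_start utE).
- by rewrite me (pcat_end unwE) (pcat_end pE).
Qed.

End NormalForms.

(** What the resolution uses of the algebra: normal paths form a basis, and
    the normal form of a path involves only smaller paths of the same length
    and with the same endpoints. *)
Record normal_forms (K : fieldType) (Q : quiver) (gt : rel (qpath Q))
    (T : {fset qpath Q}) (L : pzRingType) (qm : {rmorphism pathalg K Q -> L})
    (nf : L -> pathalg K Q) : Prop := NormalForms {
  nfD : forall l m, nf (l + m) = nf l + nf m;
  nfZ : forall a l, nf (qm (cst Q a) * l) = a *: nf l;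
  nfK : forall l, qm (nf l) = l;
  nf_normal : forall l n, nf l n != 0 -> normal T n;
  nf_path : forall p n, nf (qm (pelt K p)) n != 0 ->
    [/\ ple gt n p, plen n = plen p, pstart n = pstart p & pend n = pend p];
  nf_normal_path : forall p, normal T p -> nf (qm (pelt K p)) = pelt K p }.

Lemma normal_forms_ex (K : fieldType) (Q : quiver) (gt : rel (qpath Q))
    (T : {fset qpath Q}) (X : affine K gt T) :
  length_admissible gt -> (forall t, t \in T -> plen t = 2) -> GrAlg X ->
  exists nf, normal_forms gt T (qm X) nf.
Proof.
move=> adm T2 XG.
have nf_ex (l : quot_ring (gideal X)) : exists x, qm X x = l /\
    forall n, x n != 0 -> normal T n.
  have [y <-] : exists y, qm X y = l by exists (repr l); apply: reprK.
  elim/pathmul_ind: y => [y z [y' [yE y'n]] [z' [zE z'n]]||a y [y' [yE y'n]]|p].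
  - exists (y' + z'); rewrite !rmorphD yE zE; split=> // n; rewrite coefD.
    by have [->|/y'n//] := eqVneq (y' n) 0; rewrite add0r => /z'n.
  - by exists 0; split=> // n; rewrite coef0 eqxx.
  - exists (a *: y'); rewrite qmZ yE -qmZ; split=> // n.
    by rewrite coefZ mulf_eq0 negb_or => /andP[_ /y'n].
  - have [x xE xR] := path_reduction adm T2 X p.
    by exists x; split=> // n /xR[].
have [nf nfP] := choice nf_ex.
have nf_uniq x l : qm X x = l -> (forall n, x n != 0 -> normal T n) -> nf l = x.
  move=> xl xn; have [nl nln] := nfP l; apply/subr0_eq.
  apply: (normal_independent adm T2 XG).
    by apply/qm_eqP; rewrite nl.
  move=> p; rewrite coefD coefN.
  by have [->|/nln//] := eqVneq (nf l p) 0; rewrite sub0r oppr_eq0 => /xn.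
exists nf; split.
- move=> l m; have [[nl nln] [nm nmn]] := (nfP l, nfP m).
  apply: nf_uniq => [|n]; first by rewrite rmorphD nl nm.
  by rewrite coefD; have [->|/nln//] := eqVneq (nf l n) 0; rewrite add0r => /nmn.
- move=> a l; have [nl nln] := nfP l; apply: nf_uniq => [|n].
    by rewrite qmZ nl.
  by rewrite coefZ mulf_eq0 negb_or => /andP[_ /nln].
- by move=> l; have [] := nfP l.
- by move=> l; have [] := nfP l.
- move=> p n; have [x xE xR] := path_reduction adm T2 X p.
  rewrite (nf_uniq x) //; first by move=> /xR[].
  by move=> m /xR[].
- by move=> p pn; apply: nf_uniq => // n /pelt_coef_neq0 ->.
Qed.

(** * The resolution of the semisimple module *)

Section Resolution.
Variables (K : fieldType) (Q : quiver) (gt : rel (qpath Q)).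
Variable T : {fset qpath Q}.
Hypothesis adm : length_admissible gt.
Variables (L : pzRingType) (qm : {rmorphism pathalg K Q -> L}).
Variable nf : L -> pathalg K Q.
Hypothesis NF : normal_forms gt T qm nf.
Local Notation KQ := (pathalg K Q).
Implicit Types (l : L) (p q r u c n m : qpath Q).

Definition ka : {rmorphism K -> L} := qm \o cst Q.
Definition pel p : L := qm (pelt K p).

Lemma nf_zmod : zmod_morphism nf.
Proof.
have nfN l : nf (- l) = - nf l.
  by rewrite -[- l]mulN1r -(rmorphN1 qm) -(rmorphN1 (cst Q)) (nfZ NF) scaleN1r.
by move=> l l'; rewrite (nfD NF) nfN.
Qed.

Definition nfa : {additive L -> KQ} :=
  HB.pack nf (GRing.isZmodMorphism.Build L KQ nf nf_zmod).

Lemma nf0 : nf 0 = 0. Proof. exact: (raddf0 nfa). Qed.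

Lemma nf_eq0 l : (forall n, nf l n = 0) -> l = 0.
Proof.
move=> l0; rewrite -(nfK NF l); have -> : nf l = 0.
  by apply/fsfunP => n; rewrite l0 coef0.
by rewrite rmorph0.
Qed.

Lemma qm_ind (P : L -> Prop) :
  P 0 -> (forall x y, P x -> P y -> P (x + y)) ->
  (forall a x, P x -> P (ka a * x)) -> (forall p, P (pel p)) -> forall x, P x.
Proof.
move=> P0 PD PZ Pp x; rewrite -(nfK NF x).
elim/pathmul_ind: (nf x) => [y z Py Pz||a y Py|p].
- by rewrite rmorphD; apply: PD.
- by rewrite rmorph0.
- by rewrite -cstM rmorphM; apply: PZ.
- exact: Pp.
Qed.

Lemma nf_qm (x : KQ) : nf (qm x) = \sum_(p <- finsupp x) x p *: nf (pel p).
Proof.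
rewrite {1}[x]path_sumE rmorph_sum -[LHS]/(nfa _) raddf_sum /=.
by apply: eq_bigr => p _; rewrite -cstM rmorphM (nfZ NF).
Qed.

Lemma nf_qm_coef_neq0 (x : KQ) r : nf (qm x) r != 0 ->
  exists p, x p != 0 /\ nf (pel p) r != 0.
Proof.
rewrite nf_qm coef_sum => /sum_neq0 [p].
by rewrite coefZ mulf_eq0 negb_or => /andP[xp pr]; exists p.
Qed.

Lemma nf_qm_normal (x : KQ) : (forall p, x p != 0 -> normal T p) -> nf (qm x) = x.
Proof.
move=> xn; rewrite nf_qm [RHS]path_sumE; apply: eq_big_seq => p.
by rewrite mem_finsupp => /xn /(nf_normal_path NF) <-.
Qed.

Lemma nf_mul_coef_neq0 l l' r : nf (l * l') r != 0 ->
  exists p q pq, [/\ nf l p != 0, nf l' q != 0, pcat p q = Some pq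
    & nf (pel pq) r != 0].
Proof.
rewrite -{1}(nfK NF l) -{1}(nfK NF l') -rmorphM => /nf_qm_coef_neq0 [pq [+ pqr]].
by move=> /mul_coef_neq0 [p [q [lp lq pqE]]]; exists p, q, pq.
Qed.

Lemma nf_path_mul_neq0 u l r : nf (pel u * l) r != 0 ->
  exists q uq, [/\ nf l q != 0, pcat u q = Some uq & nf (pel uq) r != 0].
Proof.
rewrite -{1}(nfK NF l) -rmorphM => /nf_qm_coef_neq0 [uq [+ uqr]].
move=> /mul_coef_neq0 [p [q [/pelt_coef_neq0 -> lq uqE]]].
by exists q, uq.
Qed.

Lemma nf_vertex_mul v l p :
  nf (pel (pvertex v) * l) p = if v == pstart p then nf l p else 0.
Proof.
rewrite -{1}(nfK NF l) -rmorphM nf_qm_normal ?vertex_mul_coef //.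
move=> q; rewrite vertex_mul_coef; case: ifP => [_|]; rewrite ?eqxx //.
exact: (nf_normal NF).
Qed.

Lemma nf_mul_vertex v l p :
  nf (l * pel (pvertex v)) p = if pend p == v then nf l p else 0.
Proof.
rewrite -{1}(nfK NF l) -rmorphM nf_qm_normal ?mul_vertex_coef //.
move=> q; rewrite mul_vertex_coef; case: ifP => [_|]; rewrite ?eqxx //.
exact: (nf_normal NF).
Qed.

Definition len_ge j l : Prop := forall n, nf l n != 0 -> (j <= plen n)%N.

Lemma len_ge_mul i j l l' : len_ge i l -> len_ge j l' -> len_ge (i + j) (l * l').
Proof.
move=> li lj r /nf_mul_coef_neq0 [p [q [pq [/li ip /lj jq pqE]]]].
by move=> /(nf_path NF)[_ -> _ _]; rewrite (plen_cat pqE) leq_add.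
Qed.

Lemma len_ge_lin j a l l' : len_ge j l -> len_ge j l' -> len_ge j (a * l + l').
Proof.
move=> lj lj' n; rewrite (nfD NF) coefD.
have [E|al _] := eqVneq (nf (a * l) n) 0; first by rewrite E add0r => /lj'.
have a0 : len_ge 0 a by [].
exact: (len_ge_mul a0 lj al).
Qed.

(** Length is a grading of the algebra, so that in the lowest degree of [l']
    only the vertices of [l] contribute to [l * l']. *)
Lemma nf_lowest j l l' p : len_ge j l' -> plen p = j ->
  nf (l * l') p = nf l (pvertex (pstart p)) * nf l' p.
Proof.
move=> lj pj.
elim/qm_ind: l => [|x y IHx IHy|a x IH|q].
- by rewrite mul0r nf0 !coef0 mul0r.
- by rewrite mulrDl !(nfD NF) !coefD IHx IHy mulrDl.
- by rewrite -mulrA !(nfZ NF) !coefZ IH mulrA.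
have [q0|q0] := posnP (plen q).
  rewrite (plen0 q0) nf_vertex_mul (nf_normal_path NF) // peltE.
  have -> : (pvertex (pstart p) == pvertex (pstart q)) = (pstart q == pstart p).
    by apply/eqP/eqP => [[->]//|->].
  by case: ifP; rewrite ?mul1r ?mul0r.
have -> : nf (pel q) (pvertex (pstart p)) = 0.
  apply/eqP/negPn/negP => /(nf_path NF)[_ qE _ _].
  by rewrite -qE in q0.
rewrite mul0r; apply/eqP/negPn/negP => /nf_path_mul_neq0 [u [qu [/lj ju quE]]].
move=> /(nf_path NF)[_ pE _ _]; move: pE; rewrite pj (plen_cat quE) => jE.
have := leq_add q0 ju; rewrite -jE.
by rewrite ltnn.
Qed.

(** Elements of a direct sum of copies of the algebra indexed by paths; a
    basis element is a pair of a normal path [n] and an index [c], of weight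
    the product path [n c]. *)
Local Notation F := (dpow (qpath Q) L^o).
Implicit Types x y z : F.

Definition tc x c n : K := nf (x c : L) n.

Lemma tc0 c n : tc 0 c n = 0.
Proof. by rewrite /tc dpow_coef0 nf0 coef0. Qed.

Lemma tcD x y c n : tc (x + y) c n = tc x c n + tc y c n.
Proof. by rewrite /tc dpow_coefD (nfD NF) coefD. Qed.

Lemma tcZ a x c n : tc (ka a *: x) c n = a * tc x c n.
Proof. by rewrite /tc dpow_coefZ -coefZ -(nfZ NF). Qed.

Lemma tcN x c n : tc (- x) c n = - tc x c n.
Proof.
by rewrite -scaleN1r -(rmorphN1 ka) tcZ mulN1r.
Qed.

Lemma tcB x y c n : tc (x - y) c n = tc x c n - tc y c n.
Proof. by rewrite tcD tcN. Qed.

Lemma tc_sum (I : Type) (s : seq I) (G : I -> F) c n :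
  tc (\sum_(j <- s) G j) c n = \sum_(j <- s) tc (G j) c n.
Proof.
exact: (big_morph (fun x => tc x c n) (fun x y => tcD x y c n) (tc0 c n)).
Qed.

Lemma tc_eq0 x : (forall c n, tc x c n = 0) -> x = 0.
Proof.
by move=> x0; apply/fsfunP => c; rewrite dpow_coef0; apply: nf_eq0 => n; apply: x0.
Qed.

Lemma tc_neq0_supp x c n : tc x c n != 0 -> c \in finsupp x.
Proof.
rewrite mem_finsupp; apply: contraNN => /eqP xc.
by rewrite /tc xc nf0 coef0.
Qed.

Lemma tcD_neq0 x y c n : tc (x + y) c n != 0 -> tc x c n != 0 \/ tc y c n != 0.
Proof.
by rewrite tcD; have [->|] := eqVneq (tc x c n) 0; rewrite ?add0r; [right|left].
Qed.

Lemma tc_scale_neq0 l x c r : tc (l *: x) c r != 0 ->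
  exists p q pq, [/\ nf l p != 0, tc x c q != 0, pcat p q = Some pq
    & nf (pel pq) r != 0].
Proof. by rewrite /tc dpow_coefZ; apply: nf_mul_coef_neq0. Qed.

Definition el n c : F := @single L (qpath Q) L^o c (pel n).

Lemma tc_el n c c' n' :
  tc (el n c) c' n' = if c' == c then nf (pel n) n' else 0.
Proof. by rewrite /tc singleE; case: ifP; rewrite // nf0 coef0. Qed.

Lemma tc_el_normal n c c' n' : normal T n ->
  tc (el n c) c' n' = ((c' == c) && (n' == n))%:R.
Proof.
move=> nn; rewrite tc_el (nf_normal_path NF nn) peltE.
by case: (c' == c).
Qed.

(** The sum of the [L v], with [v] the start vertex of [c], over the chains
    [c] of length [k]. *)
Definition inP (k : nat) x : Prop := forall c n, tc x c n != 0 ->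
  [/\ plen c = k, chain T c & pend n = pstart c].

Lemma inP0 k : inP k 0. Proof. by move=> c n; rewrite tc0 eqxx. Qed.

Lemma inPL k l x y : inP k x -> inP k y -> inP k (l *: x + y).
Proof.
move=> xk yk c n /tcD_neq0 [|/yk//].
move=> /tc_scale_neq0 [p [q [pq [_ /xk [ck cc qc] pqE]]]].
by move=> /(nf_path NF)[_ _ _ ->]; rewrite (pcat_end pqE).
Qed.

Definition Pm k : submod F := mksub (inP0 k) (@inPL k).

Lemma inP_scale k l x : inP k x -> inP k (l *: x).
Proof. by move=> xk; rewrite -[_ *: _]addr0; apply: inPL => //; apply: inP0. Qed.

Lemma inPD k x y : inP k x -> inP k y -> inP k (x + y).
Proof. by move=> xk yk; rewrite -[x]scale1r; apply: inPL. Qed.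

Lemma inPB k x y : inP k x -> inP k y -> inP k (x - y).
Proof.
by move=> xk yk; rewrite addrC -scaleN1r; apply: inPL.
Qed.

Lemma inP_el k n c : plen c = k -> chain T c -> pend n = pstart c ->
  inP k (el n c).
Proof.
move=> ck cc nc c' n'; rewrite tc_el; case: (c' =P c) => [->|_]; last by rewrite eqxx.
by move=> /(nf_path NF)[_ _ _ ->].
Qed.

Lemma inP_val k (x : sub_of (Pm k)) : inP k (sub_incl _ x).
Proof. by apply/(mksubP (inP0 k) (@inPL k))/sub_inclP; exists x. Qed.

Lemma inP_lift k x : inP k x -> exists w, sub_incl (Pm k) w = x.
Proof. by move=> xk; apply/sub_inclP/(mksubP (inP0 k) (@inPL k)). Qed.

(** Multiplication of the coordinates by vertices splits it off from a free
    module. *)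
Lemma projective_Pm k : projective (sub_of (Pm k)).
Proof.
have rmL v : linear (fun l : L^o => (l : L) * pel (pvertex v) : L^o).
  by move=> a l l'; rewrite mulrDl -mulrA.
pose h c : {linear L^o -> F} := if (plen c == k) && chain T c
  then lcomp (dsingle L^o c) (Lin (rmL (pstart c))) else lzero L^o F.
have hE c l c' n : tc (h c l) c' n =
    if [&& c' == c, plen c == k, chain T c & pend n == pstart c]
    then nf l n else 0.
  rewrite /h; case: ifP => [/andP[-> ->]|E].
    rewrite /tc [lcomp _ _ _]/= singleE; case: ifP => _ /=.
      exact: nf_mul_vertex.
    by rewrite nf0 coef0.
  rewrite -[lzero _ _ _]/(0 : F) tc0.
  by rewrite !andbA -[_ && (plen c == k) && _]andbA E andbF.
have pP x : inP k (dsum h x).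
  move=> c n; rewrite [dsum h x]/= tc_sum => /sum_neq0 [c'].
  rewrite hE; case: ifP => [|_]; last by rewrite eqxx.
  by move=> /and4P[/eqP -> /eqP ck cc /eqP nc].
have pid x : inP k x -> dsum h x = x.
  move=> xk; apply/subr0_eq/tc_eq0 => c n; apply/eqP; rewrite tcB subr_eq0.
  rewrite [dsum h x]/= tc_sum; apply/eqP.
  have [cx|cx] := boolP (c \in finsupp x); last first.
    rewrite /tc (fsfun_dflt cx) nf0 coef0 big_seq big1 // => c' c'x.
    rewrite -/(tc _ _ _) hE; case: eqP => [cE|//].
    by rewrite cE c'x in cx.
  rewrite (big_fsetD1 c) //= big_seq big1 ?addr0 => [|c'].
    rewrite hE eqxx /=; case: ifP => // E.
    apply/esym/eqP/negPn/negP => /xk [ck cc nc].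
    by rewrite ck cc nc !eqxx in E.
  rewrite !inE => /andP[cc _]; rewrite hE; case: eqP => // cE.
  by rewrite cE eqxx in cc.
have [g gE] : exists g : {linear F -> sub_of (Pm k)},
    forall x, sub_incl _ (g x) = dsum h x.
  by apply: lift_inj (@sub_incl_inj _ _ _) _ => x; apply: inP_lift.
apply: (projective_retract (f := sub_incl (Pm k)) (g := g)); last first.
  exact: projective_free.
by move=> x; apply: sub_incl_inj; rewrite gE pid //; apply: inP_val.
Qed.

Definition supp_in x (D : qpath Q -> Prop) : Prop :=
  forall c n, tc x c n != 0 -> exists2 m, pcat n c = Some m & D m.

Definition below m : qpath Q -> Prop := fun r => ple gt r m.
Definition sbelow m : qpath Q -> Prop := fun r => gt m r.
Definition downward (D : qpath Q -> Prop) : Prop :=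
  forall m m', D m -> ple gt m' m -> D m'.

Lemma sbelow_down m : downward (sbelow m).
Proof. by move=> r s rm sr; apply: (ple_lt_trans adm) sr rm. Qed.

Lemma supp_in_impl x (D D' : qpath Q -> Prop) :
  (forall m, D m -> D' m) -> supp_in x D -> supp_in x D'.
Proof. by move=> DD xD c n /xD [m nc /DD]; exists m. Qed.

Lemma supp_inD x y D : supp_in x D -> supp_in y D -> supp_in (x + y) D.
Proof. by move=> xD yD c n /tcD_neq0 [/xD|/yD]. Qed.

Lemma supp_inZ a x D : supp_in x D -> supp_in (ka a *: x) D.
Proof. by move=> xD c n; rewrite tcZ mulf_eq0 negb_or => /andP[_ /xD]. Qed.

Lemma supp_inB x y D : supp_in x D -> supp_in y D -> supp_in (x - y) D.
Proof.
move=> xD yD; rewrite -scaleN1r -(rmorphN1 ka).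
by apply: supp_inD => //; apply: supp_inZ.
Qed.

Lemma supp_in_tc0 x D c n m : supp_in x D -> pcat n c = Some m -> ~ D m ->
  tc x c n = 0.
Proof.
move=> xD nc Dm; apply/eqP/negPn/negP => /xD [m' nc' Dm'].
by move: nc'; rewrite nc => -[mE]; rewrite mE in Dm.
Qed.

Lemma supp_el n c m : pend n = pstart c -> pcat n c = Some m ->
  supp_in (el n c) (below m).
Proof.
move=> nc_end ncE c' n'; rewrite tc_el; case: (c' =P c) => [->|_]; last by rewrite eqxx.
move=> /(nf_path NF)[n'n _ _ n'e].
have [m' n'cE] : exists r, pcat n' c = Some r by apply: pcat_ex; rewrite n'e.
by exists m' => //; apply: ple_mulr adm _ _ _ _ _ n'n n'cE ncE.
Qed.

(** Multiplication by [l] moves a term [(q, c)] to terms that are at most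
    [p q c], for the paths [p] of [l]. *)
Lemma supp_scale l x D D' : downward D' ->
  (forall p m pm, nf l p != 0 -> D m -> pcat p m = Some pm -> D' pm) ->
  supp_in x D -> supp_in (l *: x) D'.
Proof.
move=> D'down DD xD c r /tc_scale_neq0 [p [q [pq [lp xq pqE rpq]]]].
have [m qcE Dm] := xD c q xq.
have /pcatP[qc_end _ _] := qcE.
have [rle _ _ re] := nf_path NF rpq.
have [pm pqcE] : exists s, pcat pq c = Some s.
  by apply: pcat_ex; rewrite (pcat_end pqE).
have [rc rcE] : exists s, pcat r c = Some s.
  by apply: pcat_ex; rewrite re (pcat_end pqE).
exists rc => //; apply: D'down (ple_mulr adm rle rcE pqcE).
have [qc qcE' pmE] := pcat_assocl pqE pqcE.
by apply: DD lp Dm _; move: qcE'; rewrite qcE => -[->].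
Qed.

Lemma supp_path_scale u x D D' : downward D' -> normal T u ->
  (forall m um, D m -> pcat u m = Some um -> D' um) ->
  supp_in x D -> supp_in (pel u *: x) D'.
Proof.
move=> D'down un DD; apply: supp_scale => // p m pm.
rewrite (nf_normal_path NF un) => /pelt_coef_neq0 ->; exact: DD.
Qed.

Definition top x n c m : Prop :=
  [/\ tc x c n != 0, pcat n c = Some m & supp_in x (below m)].

Lemma top_ex k x : inP k x -> x != 0 -> exists n c m, top x n c m.
Proof.
move=> xk x0.
pose wt := pmap (fun nc => pcat nc.1 nc.2)
  [seq (n, c) | c <- enum_fset (finsupp x), n <- enum_fset (finsupp (nf (x c)))].
have wtP c n m : tc x c n != 0 -> pcat n c = Some m -> m \in wt.
  move=> xcn ncE; rewrite mem_pmap; apply/mapP; exists (n, c) => //.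
  apply/allpairsPdep; exists c, n; split=> //; first exact: tc_neq0_supp xcn.
  by rewrite mem_finsupp.
have xD : supp_in x (fun _ => True).
  by move=> c n /xk[_ _ /pcat_ex[m ncE]]; exists m.
have wt0 : wt != [::].
  apply: contra_neq x0 => wt0; apply: tc_eq0 => c n; apply/eqP/negPn/negP => xcn.
  by have [m ncE _] := xD c n xcn; have := wtP c n m xcn ncE; rewrite wt0.
have [m mwt mmax] := path_max adm wt0.
move: (mwt); rewrite mem_pmap => /mapP[[n c] /allpairsPdep[c' [n' [_ n'x [-> ->]]]] ncE].
exists n', c', m; split=> //; first by rewrite mem_finsupp in n'x.
move=> c1 n1 xcn; have [m1 n1c1 _] := xD c1 n1 xcn.
by exists m1 => //; apply: mmax; apply: wtP xcn n1c1.
Qed.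

Lemma sbelow_top k x m : inP k x -> supp_in x (sbelow m) ->
  x = 0 \/ exists2 m', gt m m' & supp_in x (below m').
Proof.
move=> xk xm; have [->|x0] := eqVneq x 0; [by left|right].
have [n [c [m' [xcn ncE xm']]]] := top_ex xk x0; exists m' => //.
by have [m1] := xm c n xcn; rewrite ncE => -[<-].
Qed.

(** A weight determines the term, because all indices have the length [k]. *)
Lemma tc0_sbelow k x n c m : inP k x -> plen c = k -> pcat n c = Some m ->
  supp_in x (below m) -> tc x c n = 0 -> supp_in x (sbelow m).
Proof.
move=> xk ck ncE xm x0 c' n' xcn'; have [m' n'cE m'm] := xm c' n' xcn'.
exists m' => //; case: m'm => // m'm; rewrite m'm in n'cE.
have [c'k _ _] := xk c' n' xcn'.
have [n'E c'E] := pcat_inj (etrans c'k (esym ck)) n'cE ncE.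
by rewrite n'E c'E x0 eqxx in xcn'.
Qed.

Lemma sub_top k x n c m : inP k x -> plen c = k -> chain T c -> normal T n ->
  pcat n c = Some m -> supp_in x (below m) ->
  supp_in (x - ka (tc x c n) *: el n c) (sbelow m).
Proof.
move=> xk ck cc nn ncE xm; have /pcatP[nc_end _ _] := ncE.
apply: (tc0_sbelow (k := k) _ ck ncE).
- by apply/inPB/inP_scale/inP_el.
- by apply/supp_inB/supp_inZ/supp_el.
- by rewrite tcB tcZ tc_el_normal // !eqxx mulr1 subrr.
Qed.

(** [Y] is, via [i], a submodule of the [k]-th term of the resolution that
    has the top terms of the syzygy of the monomial algebra and lies in the
    radical. *)
Record syzygy k (Y : lmodType L) (i : {linear Y -> F}) : Prop := Syzygy {
  syz_inj : injective i;
  syz_inP : forall w, inP k (i w);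
  syz_top : forall w n c m, top (i w) n c m -> exists n' a ac,
    [/\ plen a = 1%N, pcat n' a = Some n, pcat a c = Some ac & chain T ac];
  syz_gen : forall a c ac, plen c = k -> plen a = 1%N ->
    pcat a c = Some ac -> chain T ac ->
    exists2 w, top (i w) a c ac & tc (i w) c a = 1;
  syz_rad : forall w c n, tc (i w) c n != 0 -> (0 < plen n)%N }.

Arguments syz_inP {k Y i} _ w _ _ _.

Section Step.
Variables (k : nat) (Y : lmodType L) (i : {linear Y -> F}).
Hypothesis Yk : syzygy k i.

Lemma gen_ex c : exists w, plen c = k.+1 -> chain T c -> forall a c0,
  plen a = 1%N -> pcat a c0 = Some c -> top (i w) a c0 c /\ tc (i w) c0 a = 1.
Proof.
have [/andP[/eqP ck cc]|nc] := boolP ((plen c == k.+1) && chain T c); last first.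
  by exists 0 => ck cc; rewrite ck cc eqxx in nc.
have [|a [c0 [acE a1 c0k]]] := @psplit_first _ c; first by rewrite ck.
have {}c0k : plen c0 = k by apply: succn_inj; rewrite c0k.
have [y ytop y1] := syz_gen Yk c0k a1 acE cc.
exists y => _ _ a' c0' a'1 acE'.
have c0'k : plen c0' = k.
  by move: (plen_cat acE'); rewrite a'1 ck => -[].
by have [-> ->] := pcat_inj (etrans c0'k (esym c0k)) acE' acE.
Qed.

(** For a chain [c = a c0], an element of [Y] with top term [(a, c0)]. *)
Definition gen : qpath Q -> Y := projT1 (choice gen_ex).

Lemma genP c a c0 : plen c = k.+1 -> chain T c -> plen a = 1%N ->
  pcat a c0 = Some c -> top (i (gen c)) a c0 c /\ tc (i (gen c)) c0 a = 1.
Proof. by move=> ck cc; apply: (projT2 (choice gen_ex)). Qed.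

Definition boundary : {linear F -> Y} := dsum (fun c => lsmul (gen c)).

Lemma boundaryE x : boundary x = \sum_(c <- finsupp x) (x c : L) *: gen c.
Proof. by []. Qed.

Lemma i_dmapYE x :
  i (boundary x) = \sum_(c <- finsupp x) (x c : L) *: i (gen c).
Proof.
rewrite boundaryE raddf_sum; apply: eq_bigr => c _; exact: (lin_scale i).
Qed.

Lemma boundary_el n c : boundary (el n c) = pel n *: gen c.
Proof. exact: dsum_single. Qed.

Lemma chain_split c : plen c = k.+1 -> exists a c0,
  [/\ plen a = 1%N, plen c0 = k & pcat a c0 = Some c].
Proof.
move=> ck; have [|a [c0 [acE a1 c0k]]] := @psplit_first _ c; first by rewrite ck.
by exists a, c0; split=> //; apply: succn_inj; rewrite c0k.
Qed.

Lemma gen_below c : plen c = k.+1 -> chain T c -> supp_in (i (gen c)) (below c).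
Proof.
move=> ck cc; have [a [c0 [a1 _ acE]]] := chain_split ck.
by have [[]] := genP ck cc a1 acE.
Qed.

Lemma boundary_supp x D : inP k.+1 x -> downward D -> supp_in x D ->
  supp_in (i (boundary x)) D.
Proof.
move=> xk Ddown xD c' n'; rewrite i_dmapYE tc_sum => /sum_neq0 [c gcn].
have [p [_ [_ [xp _ _ _]]]] := tc_scale_neq0 gcn.
have [ck cc _] := xk c p xp.
apply: (supp_scale (D := below c) Ddown _ (gen_below ck cc) gcn).
move=> q m qm_ xq mc qmE; have [m1 qcE Dm1] := xD c q xq.
by apply: Ddown Dm1 (ple_mull adm mc qmE qcE).
Qed.

(** Products respect the order, so only the top term [(a, c0)] of [gen c] can
    contribute in weight [m] after multiplication by [n]. When [n a] is not
    normal, [el na c0] is itself of lower weight: see [el_not_normal]. *)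
Lemma boundary_el_top n c a c0 m na : plen c = k.+1 -> chain T c ->
  plen a = 1%N -> pcat a c0 = Some c -> normal T n -> pcat n c = Some m ->
  pcat n a = Some na ->
  supp_in (i (boundary (el n c)) - el na c0) (sbelow m).
Proof.
move=> ck cc a1 acE nn ncE naE; have [[_ _ gc] g1] := genP ck cc a1 acE.
have c0k : plen c0 = k by move: (plen_cat acE); rewrite a1 ck => -[].
have cc0 : chain T c0.
  have : inP k (i (gen c)) := syz_inP Yk _.
  by move=> /(_ c0 a); rewrite g1 oner_eq0 => /(_ isT)[].
have an : normal T a := normal_arrow T a1.
have := sub_top (syz_inP Yk _) c0k cc0 an acE gc.
rewrite g1 rmorph1 scale1r => gc'.
have -> : i (boundary (el n c)) - el na c0 = pel n *: (i (gen c) - el a c0).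
  rewrite boundary_el (lin_scale i) scalerBr; congr (_ - _).
  apply/fsfunP => c1; rewrite dpow_coefZ !singleE.
  case: ifP => _; last by rewrite scaler0.
  by rewrite -[RHS]/(pel n * pel a) /pel -rmorphM peltM naE.
apply: supp_path_scale gc' => //; first exact: sbelow_down.
by move=> r nr cr nrE; apply: (adm_mull adm) cr ncE nrE.
Qed.

Lemma el_not_normal na c0 m : pcat na c0 = Some m -> ~~ normal T na ->
  supp_in (el na c0) (sbelow m).
Proof.
move=> mE nna c' n'; rewrite tc_el; case: (c' =P c0) => [->|_]; last by rewrite eqxx.
move=> n'na; have [n'le _ _ n'e] := nf_path NF n'na.
have n'n := nf_normal NF n'na; have /pcatP[nc_end _ _] := mE.
have [m' m'E] : exists r, pcat n' c0 = Some r by apply: pcat_ex; rewrite n'e.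
exists m' => //; case: n'le => [n'E|lt]; last exact: (adm_mulr adm) lt mE m'E.
by rewrite -n'E n'n in nna.
Qed.

(** Remove the top terms of [w] one at a time. The bound on the preimage is what
    makes the top terms of the next syzygy predictable. *)
Lemma boundary_lift m w : supp_in (i w) (below m) ->
  exists x, [/\ inP k.+1 x, boundary x = w & supp_in x (below m)].
Proof.
elim/(well_founded_induction (adm_wf adm)): m w => m IH w wm.
have [->|w0] := eqVneq w 0.
  exists 0; split; [exact: inP0|exact: raddf0|].
  by move=> c n; rewrite tc0 eqxx.
have iw0 : i w != 0.
  by apply: contra_neq w0 => iw0; apply: (syz_inj Yk); rewrite iw0 raddf0.
have wk := syz_inP Yk w.
have [n [c [m' wtop]]] := top_ex wk iw0; have [wcn ncE wm'] := wtop.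
have [n' [a [ac [a1 naE acE cac]]]] := syz_top Yk wtop.
have [c_k cc nc_end] := wk c n wcn.
have [m1 ncE1 m'm] := wm c n wcn; move: ncE1; rewrite ncE => -[m1E].
rewrite -{m1}m1E in m'm.
have ack : plen ac = k.+1 by rewrite (plen_cat acE) a1 c_k.
have nn : normal T n := nf_normal NF wcn.
have nn' : normal T n' := normal_catl naE nn.
have n'acE : pcat n' ac = Some m'.
  have [ac' acE'] := pcat_assocl naE ncE.
  by move: acE'; rewrite acE => -[<-].
have /pcatP[n'ac_end _ _] := n'acE.
pose al := tc (i w) c n.
pose w1 := w - ka al *: boundary (el n' ac).
have w1E : i w1 = (i w - ka al *: el n c) -
    ka al *: (i (boundary (el n' ac)) - el n c).
  by rewrite /w1 (linearB i) (lin_scale i) scalerBr opprB addrA subrK.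
have w1m' : supp_in (i w1) (sbelow m').
  rewrite w1E; apply: supp_inB; first exact: sub_top wk _ _ _ _ _.
  by apply: supp_inZ; apply: boundary_el_top acE _ _ naE.
have [x1 [x1k x1w x1m]] :
    exists x1, [/\ inP k.+1 x1, boundary x1 = w1 & supp_in x1 (below m)].
  have [iw1|[m2 m2m' w1m2]] := sbelow_top (syz_inP Yk _) w1m'.
    exists 0; split; [exact: inP0| |by move=> c1 n1; rewrite tc0 eqxx].
    by apply: (syz_inj Yk); rewrite iw1 !raddf0.
  have m2m := lt_ple_trans adm m2m' m'm.
  have [x1 [x1k x1w x1m]] := IH m2 m2m w1 w1m2.
  exists x1; split=> //; apply: supp_in_impl x1m => r rm2.
  by right; apply: ple_lt_trans adm _ _ _ rm2 m2m.
exists (x1 + ka al *: el n' ac); split.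
- by apply/inPD/inP_scale/inP_el.
- by rewrite (linearD boundary) (lin_scale boundary) x1w subrK.
- apply: supp_inD => //; apply/supp_inZ/supp_in_impl/(supp_el n'ac_end n'acE).
  by move=> r rm'; apply: ple_trans adm _ _ _ rm' m'm.
Qed.

Lemma boundary_surj w : exists2 x, inP k.+1 x & boundary x = w.
Proof.
have [->|w0] := eqVneq w 0; first by exists 0; [exact: inP0|exact: raddf0].
have iw0 : i w != 0.
  by apply: contra_neq w0 => iw0; apply: (syz_inj Yk); rewrite iw0 raddf0.
have [n [c [m [_ _ wm]]]] := top_ex (syz_inP Yk w) iw0.
by have [x [xk xw _]] := boundary_lift wm; exists x.
Qed.

(** If [n a] were normal, for [c = a c0], the top term would have the image
    [(n a, c0)], which no smaller term could cancel. *)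
Lemma step_top x n c m : inP k.+1 x -> boundary x = 0 -> top x n c m ->
  exists n' b bc,
    [/\ plen b = 1%N, pcat n' b = Some n, pcat b c = Some bc & chain T bc].
Proof.
move=> xk dx0 [xcn ncE xm]; have [ck cc nc_end] := xk c n xcn.
have nn := nf_normal NF xcn.
have [a [c0 [a1 c0k acE]]] := chain_split ck.
have [na naE] : exists r, pcat n a = Some r.
  by apply: pcat_ex; rewrite nc_end (pcat_start acE).
have nac0E : pcat na c0 = Some m.
  by have [na' naE' mE] := pcat_assocr acE ncE; move: naE'; rewrite naE => -[->].
have [nan|nna] := boolP (normal T na).
  pose x' := x - ka (tc x c n) *: el n c.
  have x'k : inP k.+1 x' by apply/inPB/inP_scale/inP_el.
  have x'm := boundary_supp x'k (@sbelow_down m) (sub_top xk ck cc nn ncE xm).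
  have E : i (boundary x) = i (boundary x') + ka (tc x c n) *: i (boundary (el n c)).
    by rewrite /x' (linearB boundary) (lin_scale boundary) (linearB i) (lin_scale i) subrK.
  have /eqP := congr1 (fun z => tc z c0 na) E.
  rewrite dx0 (linear0 i) tc0 tcD tcZ.
  rewrite (supp_in_tc0 x'm nac0E) ?add0r; last by rewrite /sbelow (adm_irr adm).
  have := supp_in_tc0 (boundary_el_top ck cc a1 acE nn ncE naE) nac0E.
  rewrite /sbelow (adm_irr adm) tcB tc_el_normal // !eqxx => /(_ (fun f => notF f)).
  move=> /subr0_eq ->; rewrite mulr1 eq_sym.
  by rewrite (negPf xcn).
have [n' [b [ba [n'bE b1 baE nba]]]] := normal_extend nn a1 naE nna.
have [bc bcE] : exists r, pcat b c = Some r.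
  by apply: pcat_ex; rewrite -(pcat_end n'bE).
exists n', b, bc; split=> //.
by rewrite (chain_cons T b1 a1 acE baE bcE) nba.
Qed.

(** As [b a] is in [T], the boundary of [(b, c)] has lower weight than expected;
    subtract from [(b, c)] a lift of that boundary, which is smaller too. *)
Lemma step_gen b c bc : plen c = k.+1 -> plen b = 1%N -> pcat b c = Some bc ->
  chain T bc ->
  exists x, [/\ inP k.+1 x, boundary x = 0, top x b c bc & tc x c b = 1].
Proof.
move=> ck b1 bcE cbc; have [a [c0 [a1 c0k acE]]] := chain_split ck.
have /pcatP[bc_end _ _] := bcE.
have [ba baE] : exists r, pcat b a = Some r.
  by apply: pcat_ex; rewrite bc_end (pcat_start acE).
have := cbc; rewrite (chain_cons T b1 a1 acE baE bcE) => /andP[nba cc].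
have bn : normal T b := normal_arrow T b1.
have bac0E : pcat ba c0 = Some bc.
  by have [ba' baE' bE] := pcat_assocr acE bcE; move: baE'; rewrite baE => -[->].
have elk : inP k.+1 (el b c) by apply: inP_el.
have dm : supp_in (i (boundary (el b c))) (sbelow bc).
  rewrite -[i _](subrK (el ba c0)); apply: supp_inD; last exact: el_not_normal.
  exact: boundary_el_top acE _ _ baE.
have [x [xk xd xm]] : exists x, [/\ inP k.+1 x, boundary x = boundary (el b c)
    & supp_in x (sbelow bc)].
  have [d0|[m bcm dm']] := sbelow_top (syz_inP Yk _) dm.
    exists 0; split; [exact: inP0| |by move=> c1 n1; rewrite tc0 eqxx].
    by apply: (syz_inj Yk); rewrite d0 !raddf0.
  have [x [xk xd xm]] := boundary_lift dm'; exists x; split=> //.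
  by apply: supp_in_impl xm => r rm; apply: ple_lt_trans adm _ _ _ rm bcm.
have x1 : tc (el b c - x) c b = 1.
  rewrite tcB tc_el_normal // !eqxx (supp_in_tc0 xm bcE) ?subr0 //.
  by rewrite /sbelow (adm_irr adm).
exists (el b c - x); split=> //; first exact: inPB.
  by rewrite (linearB boundary) xd subrr.
split=> //; first by rewrite x1 oner_eq0.
apply: supp_inB; first exact: supp_el.
by apply: supp_in_impl xm => r rm; right.
Qed.

(** Minimality: the largest index [a c0] whose coefficient has a vertex among
    its terms would contribute a term [(a, c0)] that nothing else cancels. *)
Lemma step_rad x c n : inP k.+1 x -> boundary x = 0 -> tc x c n != 0 ->
  (0 < plen n)%N.
Proof.
move=> xk dx0; have [n0|//] := posnP (plen n).
rewrite (plen0 n0); set v := pstart n => xcv.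
pose s := [seq c1 <- enum_fset (finsupp x) | tc x c1 (pvertex v) != 0].
have s0 : s != [::].
  apply/eqP => s0; have : c \in s; last by rewrite s0.
  by rewrite mem_filter xcv; apply: tc_neq0_supp xcv.
have [c1 c1s c1max] := path_max adm s0.
move: c1s; rewrite mem_filter => /andP[xc1 c1x].
have [c1k cc1 vc1] := xk c1 _ xc1.
have [a [c0 [a1 c0k acE]]] := chain_split c1k.
have [[_ _ gc1] g1] := genP c1k cc1 a1 acE.
have av : pstart a = v by rewrite -(pcat_start acE) -vc1.
have := congr1 (fun z => tc z c0 a) (i_dmapYE x).
rewrite dx0 (linear0 i) tc0 tc_sum.
have E c2 : tc ((x c2 : L) *: i (gen c2)) c0 a =
    tc x c2 (pvertex v) * tc (i (gen c2)) c0 a.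
  rewrite /tc dpow_coefZ -av; apply: (nf_lowest (j := 1%N)) => // r.
  exact: (syz_rad Yk).
rewrite (eq_bigr _ (fun c2 _ => E c2)) (big_fsetD1 c1) //= g1 mulr1.
rewrite big_seq big1 ?addr0 => [/esym/eqP|c2]; first by rewrite (negPf xc1).
rewrite !inE => /andP[c21 c2x].
have [->|xc2] := eqVneq (tc x c2 (pvertex v)) 0; first by rewrite mul0r.
have [c2k cc2 _] := xk c2 _ xc2.
rewrite (supp_in_tc0 (gen_below c2k cc2) acE) ?mulr0 // => c12.
have : c2 \in s by rewrite mem_filter xc2.
move=> /c1max [c2E|c2lt]; first by rewrite c2E eqxx in c21.
exact: (ple_gt_false adm c12 c2lt).
Qed.

End Step.

(** One step of the resolution, at position [k]: iterating [cover_step] resolves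
    [Z]. *)
Definition cover k (Z : lmodType L) (g : {linear sub_of (Pm k) -> Z}) : Prop :=
  (forall w : Z, exists w', g w' = w) /\
  syzygy k (lcomp (sub_incl (Pm k)) (sub_incl (ker g))).

Lemma cover_intro k (Z : lmodType L) (d : {linear F -> Z}) :
  (forall w : Z, exists2 x, inP k x & d x = w) ->
  (forall x n c m, inP k x -> d x = 0 -> top x n c m -> exists n' a ac,
    [/\ plen a = 1%N, pcat n' a = Some n, pcat a c = Some ac & chain T ac]) ->
  (forall a c ac, plen c = k -> plen a = 1%N ->
    pcat a c = Some ac -> chain T ac ->
    exists x, [/\ inP k x, d x = 0, top x a c ac & tc x c a = 1]) ->
  (forall x c n, inP k x -> d x = 0 -> tc x c n != 0 -> (0 < plen n)%N) ->
  cover (lcomp d (sub_incl (Pm k))).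
Proof.
move=> d_surj dtop dgen drad; set g := lcomp d _.
have wk w : inP k (lcomp (sub_incl (Pm k)) (sub_incl (ker g)) w).
  exact: inP_val.
have wd w : d (lcomp (sub_incl (Pm k)) (sub_incl (ker g)) w) = 0.
  by apply/(kerP g)/sub_inclP; exists w.
split.
  move=> y; have [x xk <-] := d_surj y; have [x' <-] := inP_lift xk.
  by exists x'.
split.
- by move=> w w' /sub_incl_inj/sub_incl_inj.
- exact: wk.
- by move=> w n c m; apply: dtop.
- move=> a c ac ck a1 acE cac; have [x [xk xd xtop x1]] := dgen a c ac ck a1 acE cac.
  have [x' x'E] := inP_lift xk.
  have [w wE] : exists w, sub_incl (ker g) w = x'.
    by apply/sub_inclP/kerP; rewrite -xd -x'E.
  by exists w; rewrite -[lcomp _ _ w]/(sub_incl (Pm k) (sub_incl (ker g) w)) wE x'E.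
- by move=> w c n; apply: drad.
Qed.

Lemma cover_step k (Y : lmodType L) (i : {linear Y -> F}) : syzygy k i ->
  exists g : {linear sub_of (Pm k.+1) -> Y}, cover g.
Proof.
move=> Yk; exists (lcomp (boundary Yk) (sub_incl (Pm k.+1))); apply: cover_intro.
- exact: boundary_surj.
- exact: step_top.
- exact: step_gen.
- exact: step_rad.
Qed.

Lemma short_exact_cover k (Z : lmodType L) (g : {linear sub_of (Pm k) -> Z}) :
  cover g -> short_exact (sub_incl (ker g)) g.
Proof. by move=> [g_surj _]; apply: ker_exact. Qed.

Lemma cover_chain k (Z : lmodType L) (g : {linear sub_of (Pm k) -> Z}) :
  cover g ->
  (forall w : sub_of (ker g), w = 0) <->
  (forall c, plen c = k.+1 -> ~~ chain T c).
Proof.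
move=> [_ gk]; split=> [w0 c ck|nochain w].
  apply/negP => cc; have [|a [c0 [acE a1 c0k]]] := @psplit_first _ c.
    by rewrite ck.
  have {}c0k : plen c0 = k by apply: succn_inj; rewrite c0k.
  have [w _] := syz_gen gk c0k a1 acE cc.
  by rewrite [w]w0 (linear0 (lcomp _ _)) tc0 => /esym/eqP; rewrite oner_eq0.
set i := lcomp _ _ in gk; have [//|w0] := eqVneq w 0.
have iw0 : i w != 0.
  by apply: contra_neq w0 => iw0; apply: (syz_inj gk); rewrite iw0 (linear0 i).
have [n [c [m wtop]]] := top_ex (syz_inP gk w) iw0.
have [n' [a [ac [a1 _ acE cac]]]] := syz_top gk wtop.
have [wcn _ _] := wtop; have [ck _ _] := syz_inP gk w c n wcn.
by have := nochain ac; rewrite (plen_cat acE) a1 ck cac => /(_ erefl).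
Qed.

(** The elements of a direct summand [ker g] are combinations of the images
    [r (e0 c)] under the retraction. If [ker g] lies in the radical then both
    the coefficients and these images have terms of positive length, and so the
    lengths grow without bound. *)
Lemma cover_projective k (Z : lmodType L) (g : {linear sub_of (Pm k) -> Z}) :
  cover g -> projective Z -> forall w : sub_of (ker g), w = 0.
Proof.
move=> gk Zproj; have [g_surj gsyz] := gk.
have [s sE] := Zproj _ _ g (lid Z) g_surj.
have [r rE] : exists r : {linear sub_of (Pm k) -> sub_of (ker g)},
    forall w, sub_incl _ (r w) = w - s (g w).
  apply: (lift_inj (f := lsub (lid _) (lcomp s g))); first exact: sub_incl_inj.
  by move=> x; apply/sub_inclP/kerP; rewrite /= linearB /= sE subrr.
have rK w : r (sub_incl (ker g) w) = w.
  apply: sub_incl_inj; rewrite rE.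
  have -> : g (sub_incl (ker g) w) = 0 by apply/(kerP g)/sub_inclP; exists w.
  by rewrite (linear0 s) subr0.
pose i := lcomp (sub_incl (Pm k)) (sub_incl (ker g)).
have ilen j : forall w c, len_ge j (i w c).
  elim: j => [//|j IH] w c.
  (* The generator of index [c1], as an element of the subtype. *)
  pose e0 c1 : sub_of (Pm k) := if pselect (exists w', sub_incl (Pm k) w' =
    el (pvertex (pstart c1)) c1) is left h then projT1 (cid h) else 0.
  have e0E c1 : i w c1 != 0 -> sub_incl _ (e0 c1) = el (pvertex (pstart c1)) c1.
    move=> wc1; rewrite /e0; case: pselect => [h|[]]; first exact: (projT2 (cid h)).
    apply: inP_lift; have [n wn] : exists n, tc (i w) c1 n != 0.
      apply: contrapT => /forallNP nf0'; case/eqP: wc1; apply: nf_eq0 => n.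
      by apply/eqP/negPn/negP/nf0'.
    by have [c1k cc1 _] := syz_inP gsyz w c1 n wn; apply: inP_el.
  have wE : sub_incl (ker g) w =
      \sum_(c1 <- finsupp (i w)) (i w c1 : L) *: e0 c1.
    apply: sub_incl_inj; rewrite (linear_sum (sub_incl (Pm k))).
    rewrite -[LHS]/(i w) [LHS]dpow_sumE; apply: eq_big_seq => c1.
    rewrite mem_finsupp => wc1; rewrite (lin_scale (sub_incl _)) e0E //.
    apply/fsfunP => c2; rewrite dpow_coefZ !singleE.
    case: ifP => _; last by rewrite scaler0.
    apply/subr0_eq/nf_eq0 => n.
    have nfB l l' : nf (l - l') = nf l - nf l' by exact: (raddfB nfa).
    rewrite nfB coefD coefN [X in _ - X]nf_mul_vertex.
    case: ifP => [_|nE]; first by rewrite subrr.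
    rewrite subr0; apply/eqP/negPn/negP => wn.
    by have [_ _ nE'] := syz_inP gsyz w c1 n wn; rewrite nE' eqxx in nE.
  have {}wE : w = \sum_(c1 <- finsupp (i w)) (i w c1 : L) *: r (e0 c1).
    rewrite -{1}(rK w) {1}wE (linear_sum r); apply: eq_bigr => c1 _.
    exact: (lin_scale r).
  have wcE : i w c = \sum_(c1 <- finsupp (i w)) (i w c1 : L) * (i (r (e0 c1)) c : L).
    rewrite {1}wE (linear_sum i) -[LHS]/(dcoef _ c _) (linear_sum (dcoef _ c)).
    apply: eq_bigr => c1 _; rewrite (lin_scale i) (lin_scale (dcoef _ c)) //.
  rewrite wcE; elim/big_ind: _ => [n|l l' ll ll'|c1 _].
  - by rewrite nf0 coef0 eqxx.
  - by rewrite -[l]mul1r; apply: len_ge_lin.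
  - rewrite -[j.+1]add1n; apply: len_ge_mul (IH _ _) => n.
    exact: (syz_rad gsyz).
move=> w; apply: (syz_inj gsyz); rewrite (linear0 (lcomp _ _)); apply: tc_eq0 => c n.
apply/eqP/negPn/negP => wn; have := ilen (plen n).+1 w c n wn.
by rewrite ltnn.
Qed.

(** By minimality the resolution stops when its terms do, and the term in
    degree [k] vanishes when there is no chain of length [k]. *)
Lemma cover_dim j k (Z : lmodType L) (g : {linear sub_of (Pm k) -> Z}) :
  cover g ->
  syz_ex j Z <-> (forall c, plen c = (k + j).+1 -> ~~ chain T c).
Proof.
elim: j k Z g => [|j IH] k Z g gk.
  rewrite addn0 -(cover_chain gk); split=> [|ker0_]; first exact: cover_projective.
  have g_inj : injective g.
    move=> x y gxy; apply/subr0_eq.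
    have [w <-] : exists w, sub_incl (ker g) w = x - y.
      by apply/sub_inclP/kerP; rewrite (linearB g) gxy subrr.
    by rewrite [w]ker0_ raddf0.
  have [g_surj _] := gk.
  have [h hE] := lift_inj (f := lid Z) g_inj g_surj.
  by apply: (projective_retract hE); apply: projective_Pm.
have [g1 g1k] := cover_step gk.2.
have kj : (k + j.+1 = k.+1 + j)%N by rewrite addnS.
rewrite kj -(IH _ _ _ g1k); split=> [Zj|kerj].
  apply: syz_all_ex; have ZZ : stable_retract Z Z.
    exact: (retract_stable (f := lid Z) (g := lid Z)).
  have := syz_ex_all Zj ZZ; apply; last exact: short_exact_cover.
  exact: projective_Pm.
exists (sub_of (Pm k)), (sub_of (ker g)), (sub_incl _), g.
by split=> //; [apply: projective_Pm|apply: short_exact_cover].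
Qed.


(** * Global dimension *)

Lemma len_ge0 j : len_ge j 0.
Proof. by move=> n; rewrite nf0 coef0 eqxx. Qed.

Definition rad : submod L^o := @mksub L L^o (len_ge 1) (len_ge0 1) (@len_ge_lin 1).

Lemma radP l : l \in submod_pred rad <-> len_ge 1 l.
Proof. exact: (@mksubP L L^o (len_ge 1)). Qed.

(** The algebra modulo its arrows, as a left module. *)
Definition ssmod : lmodType L := mquot rad.

Definition aug : {linear F -> L^o} := dsum (fun _ => lid L^o).

Lemma nf_aug x n : inP 0 x -> nf (aug x) n = tc x (pvertex (pend n)) n.
Proof.
move=> x0; have nf_sum (s : seq (qpath Q)) (G : qpath Q -> L) :
    nf (\sum_(c <- s) G c) n = \sum_(c <- s) nf (G c) n.
  by rewrite -[nf _]/(nfa _) raddf_sum coef_sum.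
rewrite [aug x]/= nf_sum; set c := pvertex _.
have xc c' : tc x c' n != 0 -> c' = c.
  by move=> /x0[/plen0 cE _ nc]; rewrite /c nc.
have [cx|cx] := boolP (c \in finsupp x).
  rewrite (big_fsetD1 c) //= big_seq big1 ?addr0 // => c'.
  rewrite !inE => /andP[cc' _]; apply/eqP/negPn/negP => /xc c'E.
  by rewrite c'E eqxx in cc'.
rewrite /tc (fsfun_dflt cx) nf0 coef0 big_seq big1 // => c' c'x.
by apply/eqP/negPn/negP => /xc c'E; rewrite c'E in c'x; rewrite c'x in cx.
Qed.

Lemma pel_one : \sum_(v : vertex Q) pel (pvertex v) = 1.
Proof. by rewrite -(rmorph_sum qm) -one_sumE rmorph1. Qed.

Lemma cover_ssmod : exists g : {linear sub_of (Pm 0) -> ssmod}, cover g.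
Proof.
pose d := lcomp (mproj rad) aug.
have dP x : d x = 0 <-> len_ge 1 (aug x).
  by split=> [/mproj_eq0/radP|/radP/mproj_eq0].
exists (lcomp d (sub_incl (Pm 0))).
have d_rad x c n : inP 0 x -> d x = 0 -> tc x c n != 0 -> (0 < plen n)%N.
  move=> x0 /dP aug1 xcn; apply: aug1; rewrite nf_aug //.
  by have [/plen0 cE _ nc] := x0 c n xcn; rewrite nc -cE.
apply: cover_intro => //.
- move=> w; have [l <-] := mproj_surj w.
  pose x := \sum_(v : vertex Q) el (pvertex v) (pvertex v).
  have x0 : inP 0 x.
    rewrite /x; elim/big_ind: _ => [|y z|v _]; [exact: inP0|exact: inPD|].
    exact: inP_el.
  exists ((l : L) *: x); first exact: inP_scale.
  rewrite -[LHS]/(mproj rad (aug _)) (lin_scale aug) (linear_sum aug).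
  congr (mproj rad _); rewrite -[RHS]mulr1 -pel_one; congr (_ * _).
  by apply: eq_bigr => v _; apply: dsum_single.
- move=> x n c m x0 dx0 [xcn ncE _].
  have n0 := d_rad x c n x0 dx0 xcn; have [c0 _ nc_end] := x0 c n xcn.
  have [n' [a [naE a1 _]]] := psplit_last n0.
  have [ac acE] : exists r, pcat a c = Some r.
    by apply: pcat_ex; rewrite -(pcat_end naE).
  exists n', a, ac; split=> //; apply: chain_arrow.
  by rewrite (plen_cat acE) a1 c0.
- move=> a c ac c0 a1 acE cac; have /pcatP[ac_end _ _] := acE.
  have an : normal T a := normal_arrow T a1.
  have cc : chain T c by rewrite (plen0 c0).
  exists (el a c); split.
  + exact: inP_el.
  + apply/dP; rewrite -[aug _]/(dsum _ _) dsum_single => n.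
    by rewrite -[lid _ _]/(pel a) (nf_normal_path NF an) => /pelt_coef_neq0 ->; rewrite a1.
  + split=> //; last exact: supp_el.
    by rewrite tc_el_normal // !eqxx oner_eq0.
  + by rewrite tc_el_normal // !eqxx.
Qed.

Lemma rad_ssmod l (u : ssmod) : len_ge 1 l -> l *: u = 0.
Proof.
move=> l1; have [l' <-] := mproj_surj u.
rewrite -(lin_scale (mproj rad)); apply/mproj_eq0/radP.
have l'0 : len_ge 0 l' by [].
exact: len_ge_mul l1 l'0.
Qed.

Lemma ka_central a l : l * ka a = ka a * l.
Proof.
rewrite -(nfK NF l) /= -!rmorphM cstM; congr (qm _).
by rewrite /= cst_fun.unlock scaleMr mulr1.
Qed.

(** A section over the field becomes linear over the algebra by averaging it
    over the vertices, because the arrows act as zero on both sides. *)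
Lemma semisimple_retract (M : lmodType L) :
  (forall l (m : M), len_ge 1 l -> l *: m = 0) ->
  exists (f : {linear M -> dpow M ssmod}) (g : {linear dpow M ssmod -> M}),
    forall w, g (f w) = w.
Proof.
move=> radM.
have hm (m : M) : exists h : {linear ssmod -> M}, forall l, h (mproj rad l) = l *: m.
  by apply: (mquot_lift (f := lsmul m)) => l /radP l1; apply: radM.
have [h hE] := choice hm.
pose g := dsum h.
have g_surj (m : M) : exists w, g w = m.
  by exists (single m (mproj rad (1 : L))); rewrite dsum_single hE scale1r.
have [s [sD sZ gs]] := field_section ka g_surj.
have s0 : s 0 = 0.
  by have := sZ 0 0; rewrite rmorph0 !scale0r.
have radF l (x : dpow M ssmod) : len_ge 1 l -> l *: x = 0.
  by move=> l1; apply/fsfunP => m; rewrite dpow_coefZ dpow_coef0 rad_ssmod.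
pose f (m : M) := \sum_(v : vertex Q) pel (pvertex v) *: s (pel (pvertex v) *: m).
have fD (m m' : M) : f (m + m') = f m + f m'.
  rewrite /f -big_split; apply: eq_bigr => v _ /=.
  by rewrite scalerDr sD scalerDr.
have f0 : f 0 = 0.
  by rewrite /f big1 // => v _; rewrite scaler0 s0 scaler0.
have pelM p q : pel p * pel q = qm (pelt K p * pelt K q) by rewrite -rmorphM.
have fZ l (m : M) : f (l *: m) = l *: f m.
  elim/qm_ind: l m => [m|l l' IH IH' m|a l IH m|p m].
  - by rewrite !scale0r f0.
  - by rewrite !scalerDl fD IH IH'.
  - rewrite -!scalerA -IH /f scaler_sumr; apply: eq_bigr => v _.
    by rewrite !scalerA ka_central -!scalerA sZ !scalerA ka_central.
  have [p0|p1] := posnP (plen p); last first.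
    have pl : len_ge 1 (pel p) by move=> n /(nf_path NF)[_ ->].
    by rewrite radM // f0 radF.
  rewrite (plen0 p0); set v := pstart p; rewrite /f scaler_sumr.
  apply: eq_bigr => w _; rewrite !scalerA !pelM !peltM !pcat1p.
  case: eqVneq => [->|_] //=.
  by rewrite rmorph0 !scale0r s0 scaler0.
have fL : linear f by move=> l m m'; rewrite fD fZ.
exists (Lin fL), g => m.
rewrite -[LHS]/(g (\sum_v _)) (linear_sum g) -[RHS]scale1r -pel_one scaler_suml.
apply: eq_bigr => v _; rewrite (lin_scale g) gs scalerA pelM peltM pcat1p.
by rewrite eqxx.
Qed.

(** The horseshoe lemma along the socle series, whose layers are killed by the
    arrows. *)
Lemma syz_ex_nilpotent d j (M : lmodType L) : syz_ex d ssmod ->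
  (forall l (m : M), len_ge j l -> l *: m = 0) -> syz_ex d M.
Proof.
move=> Sd; elim: j M => [|j IH] M Mj.
  apply: syz_ex_projective; apply: projective_triv => m.
  by rewrite -[m]scale1r; apply: Mj.
have soc0 l : len_ge 1 l -> l *: (0 : M) = 0 by rewrite scaler0.
have socL (b : L) (m m' : M) :
    (forall l, len_ge 1 l -> l *: m = 0) -> (forall l, len_ge 1 l -> l *: m' = 0) ->
    forall l, len_ge 1 l -> l *: (b *: m + m') = 0.
  move=> m0 m'0 l l1; rewrite scalerDr m'0 // addr0 scalerA; apply: m0.
  have b0 : len_ge 0 b by [].
  exact: len_ge_mul l1 b0.
pose soc := mksub soc0 socL.
have socP (m : M) : m \in submod_pred soc <-> forall l, len_ge 1 l -> l *: m = 0.
  exact: mksubP.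
have soc_exact : short_exact (sub_incl soc) (mproj soc).
  split; [exact: sub_incl_inj|exact: mproj_surj|].
  by move=> m; rewrite mproj_eq0 sub_inclP.
apply: syz_ex_extension soc_exact _ _.
  have socM l (m : sub_of soc) : len_ge 1 l -> l *: m = 0.
    move=> l1; apply: sub_incl_inj; rewrite (lin_scale (sub_incl soc)) linear0.
    have /socP : sub_incl soc m \in submod_pred soc by apply/sub_inclP; exists m.
    exact.
  have [f [g gf]] := semisimple_retract socM.
  exact: syz_ex_retract gf (syz_ex_dpow _ Sd).
apply: IH => l u lj; have [m <-] := mproj_surj u.
rewrite -(lin_scale (mproj soc)); apply/mproj_eq0/socP => l' l'1.
by rewrite scalerA; apply: Mj; rewrite -[j.+1]add1n; apply: len_ge_mul.
Qed.

(** The chains decide the projective dimension of [ssmod]; the bound on the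
    lengths of normal paths makes the radical nilpotent, so that no other module
    has a larger one. *)
Lemma gldim_leP d : (exists N, forall p, normal T p -> (plen p < N)%N) ->
  gldim_le L d <-> (forall c, plen c = d.+1 -> ~~ chain T c).
Proof.
move=> [N Nnormal]; have [g gk] := cover_ssmod.
rewrite -(cover_dim d gk); split=> [Ld|Sd M]; first exact: pdim_syz_ex.
apply/syz_ex_pdim/(syz_ex_nilpotent (j := N) Sd) => l m lN.
rewrite [l]nf_eq0 ?scale0r // => n; apply/eqP/negPn/negP => ln.
by have := Nnormal n (nf_normal NF ln); rewrite ltnNge lN.
Qed.

End Resolution.

Lemma eq_gldim (R R' : pzRingType) :
  (forall d, gldim_le R d <-> gldim_le R' d) -> gldim R = gldim R'.
Proof.
move=> RR'; rewrite /gldim.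
have le_ex d : `[< gldim_le R d >] = `[< gldim_le R' d >].
  by apply/asboolP/asboolP => /RR'.
case: pselect => [b|nb]; case: pselect => [b'|nb'] //.
- congr Some; case: ex_minnP => m mR mmin; case: ex_minnP => m' m'R m'min.
  apply/eqP; rewrite eqn_leq; apply/andP; split.
    by apply: mmin; rewrite le_ex.
  by apply: m'min; rewrite -le_ex.
- by case: nb'; case: b => m mR; exists m; rewrite -le_ex.
- by case: nb; case: b' => m mR; exists m; rewrite le_ex.
Qed.

Theorem corollary4p7 (K : fieldType) (Q : quiver) (gt : rel (qpath Q))
    (T : {fset qpath Q}) (I I' : ideal (pathalg K Q)) :
  length_admissible gt ->
  (forall t, t \in T -> plen t = 2) ->
  finite_set (nontips K gt T) ->
  in_GrAlg gt T I -> in_GrAlg gt T I' ->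
  gldim (quot_ring I) = gldim (quot_ring I').
Proof.
move=> adm T2 fin [X XG ->] [X' X'G ->].
have [N Nnormal] : exists N, forall p, normal T p -> (plen p < N)%N.
  have /finite_fsetP[A AE] := fin.
  exists (\max_(p : A) plen (val p)).+1 => p /(nontipsP K gt T2).
  rewrite AE => pA; rewrite ltnS.
  exact: (leq_bigmax (F := fun q : A => plen (val q)) [` pA]%fset).
have [nf NF] := normal_forms_ex adm T2 XG.
have [nf' NF'] := normal_forms_ex adm T2 X'G.
apply: eq_gldim => d.
rewrite (gldim_leP adm NF); last by exists N.
by rewrite (gldim_leP adm NF'); last by exists N.
Qed.
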